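(* Let $R$ be a commutative noetherian ring and let $S/R$ be relative Frobenius of rank $4$. Then $\Pi_R(S)$ is noetherian and is finite (i.e. finitely generated as a module) over its center.
   Context: Relative Frobenius pairs: let $R\to S$ be a morphism of commutative rings. $S/R$ is relative Frobenius of rank $n$ if $S$ is a free $R$-module of rank $n$ and $\operatorname{Hom}_R(S,R)\cong S$ as $S$-modules. Generalized preprojective algebra: given such a pair, let $R\oplus S$ be the product ring. Let $M={}_RS_S$, viewed as an $R\oplus S$-bimodule with $R$ acting on the left, $S$ acting on the right and the other components acting by zero. Let $N={}_SS_R$, viewed as an $R\oplus S$-bimodule with $S$ acting on the left, $R$ acting on the right and the other components acting by zero. Put $T(R,S)=T_{R\oplus S}(M\oplus N)$ (tensor algebra over $R\oplus S$, graded by tensor degree). Then $M\otimes_{R\oplus S}M=N\otimes_{R\oplus S}N=0$, $M\otimes_{R\oplus S}N=S\otimes_SS$ (an $R$-$R$-bimodule) and $N\otimes_{R\oplus S}M=S\otimes_RS$ (an $S$-$S$-bimodule). Let $\lambda$ be a generator of $\operatorname{Hom}_R(S,R)$ as an $S$-module and let $(e_i)_i,(f_j)_j$ be $R$-bases of $S$ with $\lambda(e_if_j)=\delta_{ij}$. Then $\Pi_R(S)=T(R,S)/I$, where $I$ is the two-sided ideal generated by the degree $2$ elements $1\otimes 1\in M\otimes_{R\oplus S}N$ and $\sum_ie_i\otimes f_i\in N\otimes_{R\oplus S}M$. It is an $\mathbb{N}$-graded $R$-algebra (via $r\mapsto(r,r\cdot1_S)\in R\oplus S$), independent of the choices up to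 isomorphism. *)

(* Defs.v *)
From HB Require Import structures.
From mathcomp Require Import all_boot all_algebra.
From mathcomp Require Import generic_quotient ring_quotient.
From mathcomp Require Import boolp classical_sets.
From mathcomp.multinomials Require Import freeg.

Set Implicit Arguments.
Unset Strict Implicit.
Unset Printing Implicit Defensive.

Import GRing.Theory.
Local Open Scope ring_scope.
Local Open Scope quotient_scope.

(* Rings are [pzRingType]s throughout, so the zero ring is allowed. *)

Definition left_ideal (A : pzRingType) (I : set A) : Prop :=
  [/\ I 0, forall x y, I x -> I y -> I (x - y) &
      forall a x, I x -> I (a * x)].

Definition left_noetherian (A : pzRingType) : Prop :=
  forall I : set A, left_ideal I ->
    exists (m : nat) (g : 'I_m -> A),
      forall x, I x <-> exists c : 'I_m -> A, x = \sum_i c i * g i.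

(* [A^c] is the opposite ring, whose left ideals are the right ideals of [A]. *)
Definition noetherian (A : pzRingType) : Prop :=
  left_noetherian A /\ left_noetherian A^c.

Definition in_center (A : pzRingType) (z : A) : Prop :=
  forall x, z * x = x * z.

Definition finite_over_center (A : pzRingType) : Prop :=
  exists (m : nat) (g : 'I_m -> A), forall x,
    exists z : 'I_m -> A,
      (forall i, in_center (z i)) /\ x = \sum_i z i * g i.

Definition is_subgroup (V : zmodType) (H : set V) : Prop :=
  H 0 /\ forall x y, H x -> H y -> H (x - y).

Definition subgroup_gen (V : zmodType) (X : set V) : {pred V} :=
  fun x => `[< smallest (@is_subgroup V) X x >].

Lemma subgroup_gen_closed (V : zmodType) (X : set V) :
  zmod_closed (subgroup_gen X).
Proof.
split; first by apply/asboolP => H [[]].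
move=> x y /asboolP Hx /asboolP Hy; apply/asboolP => H HX.
by case: (HX) => -[_ HB] _; apply: HB; [apply: Hx|apply: Hy].
Qed.

HB.instance Definition _ (V : zmodType) (X : set V) :=
  GRing.isZmodClosed.Build V (subgroup_gen X) (subgroup_gen_closed X).

Lemma subgroup_gen_sub (V : zmodType) (X : set V) x :
  X x -> x \in subgroup_gen X.
Proof. by move=> Xx; apply/asboolP => H [_]; apply. Qed.

Lemma subgroup_gen_min (V : zmodType) (X H : set V) :
  is_subgroup H -> (X `<=` H)%classic -> forall x, x \in subgroup_gen X -> H x.
Proof. by move=> HH XH x /asboolP; apply. Qed.

Definition is_ideal (A : pzRingType) (I : set A) : Prop :=
  is_subgroup I /\ forall a x, I x -> I (a * x) /\ I (x * a).

Definition ideal_gen (A : pzRingType) (X : set A) : {pred A} :=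
  fun x => `[< smallest (@is_ideal A) X x >].

Lemma ideal_gen_closed (A : pzRingType) (X : set A) :
  zmod_closed (ideal_gen X).
Proof.
split; first by apply/asboolP => H [[[]]].
move=> x y /asboolP Hx /asboolP Hy; apply/asboolP => H HX.
by case: (HX) => -[[_ HB] _] _; apply: HB; [apply: Hx|apply: Hy].
Qed.

HB.instance Definition _ (A : pzRingType) (X : set A) :=
  GRing.isZmodClosed.Build A (ideal_gen X) (ideal_gen_closed X).

Lemma ideal_gen_sub (A : pzRingType) (X : set A) x :
  X x -> x \in ideal_gen X.
Proof. by move=> Xx; apply/asboolP => H [_]; apply. Qed.

Lemma ideal_genMl (A : pzRingType) (X : set A) a x :
  x \in ideal_gen X -> a * x \in ideal_gen X.
Proof.
move=> /asboolP Hx; apply/asboolP => H HX.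
by case: (HX) => -[_ HM] _; apply: (HM a x _).1; apply: Hx.
Qed.

Lemma ideal_genMr (A : pzRingType) (X : set A) a x :
  x \in ideal_gen X -> x * a \in ideal_gen X.
Proof.
move=> /asboolP Hx; apply/asboolP => H HX.
by case: (HX) => -[_ HM] _; apply: (HM a x _).2; apply: Hx.
Qed.

Definition quot_ring (A : pzRingType) (X : set A) : Type :=
  Quotient.quot (ideal_gen X).

Section QuotRing.
Context (A : pzRingType) (X : set A).

HB.instance Definition _ := GRing.Zmodule.on (quot_ring X).

Definition qproj : A -> quot_ring X := \pi_(Quotient.quot (ideal_gen X)).

Lemma qproj_repr (x : quot_ring X) : exists a, x = qproj a.
Proof. by exists (repr x); rewrite /qproj reprK. Qed.

Lemma qprojP a b : qproj a = qproj b <-> a - b \in ideal_gen X.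
Proof.
rewrite /qproj; split.
  by move/eqP; rewrite -Quotient.idealrBE.
by rewrite Quotient.idealrBE => /eqP.
Qed.

Lemma qproj_is_zmod_morphism : zmod_morphism qproj.
Proof. by move=> x y; rewrite /qproj !piE. Qed.

HB.instance Definition _ :=
  GRing.isZmodMorphism.Build A (quot_ring X) qproj qproj_is_zmod_morphism.

Definition quot_one : quot_ring X := qproj 1.
Definition quot_mul (x y : quot_ring X) : quot_ring X :=
  qproj (repr (x : Quotient.quot (ideal_gen X)) *
         repr (y : Quotient.quot (ideal_gen X))).

Lemma quot_mulE a b : quot_mul (qproj a) (qproj b) = qproj (a * b).
Proof.
apply/qprojP; set a' := repr _; set b' := repr _.
have Ha : a' - a \in ideal_gen X.
  by apply/qprojP; rewrite /qproj /a' reprK.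
have Hb : b' - b \in ideal_gen X.
  by apply/qprojP; rewrite /qproj /b' reprK.
have -> : a' * b' - a * b = (a' - a) * b' + a * (b' - b).
  by rewrite mulrBl mulrBr addrA subrK.
by apply: rpredD; [apply: ideal_genMr|apply: ideal_genMl].
Qed.

Fact quot_mulA : associative quot_mul.
Proof.
move=> x y z; case: (qproj_repr x) => a ->; case: (qproj_repr y) => b ->.
by case: (qproj_repr z) => c ->; rewrite !quot_mulE mulrA.
Qed.
Fact quot_mul1 : left_id quot_one quot_mul.
Proof. by move=> x; case: (qproj_repr x) => a ->; rewrite quot_mulE mul1r. Qed.
Fact quot_1mul : right_id quot_one quot_mul.
Proof. by move=> x; case: (qproj_repr x) => a ->; rewrite quot_mulE mulr1. Qed.
Fact quot_mulDl : left_distributive quot_mul +%R.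
Proof.
move=> x y z; case: (qproj_repr x) => a ->; case: (qproj_repr y) => b ->.
case: (qproj_repr z) => c ->.
by rewrite -raddfD !quot_mulE -raddfD mulrDl.
Qed.
Fact quot_mulDr : right_distributive quot_mul +%R.
Proof.
move=> x y z; case: (qproj_repr x) => a ->; case: (qproj_repr y) => b ->.
case: (qproj_repr z) => c ->.
by rewrite -raddfD !quot_mulE -raddfD mulrDr.
Qed.

HB.instance Definition _ := GRing.Zmodule_isPzRing.Build (quot_ring X)
  quot_mulA quot_mul1 quot_1mul quot_mulDl quot_mulDr.

Fact qproj_is_monoid_morphism : monoid_morphism qproj.
Proof. by split=> // a b; rewrite [RHS]quot_mulE. Qed.

HB.instance Definition _ :=
  GRing.isMonoidMorphism.Build A (quot_ring X) qproj qproj_is_monoid_morphism.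

End QuotRing.

HB.mixin Record Lmodule_isBimodule (A : pzRingType) B of GRing.Lmodule A B := {
  ract : B -> A -> B;
  ractA : forall b a a', ract (ract b a) a' = ract b (a * a');
  ract1 : forall b, ract b 1 = b;
  ractDl : forall b b' a, ract (b + b') a = ract b a + ract b' a;
  ractDr : forall b a a', ract b (a + a') = ract b a + ract b a';
  ractZ : forall a b a', ract (a *: b) a' = a *: ract b a'
}.

#[short(type="bimodType")]
HB.structure Definition Bimodule (A : pzRingType) :=
  {B of GRing.Lmodule A B & Lmodule_isBimodule A B}.

Section DirectSumBimodule.
Context (A : pzRingType) (B C : bimodType A).

Definition pair_ract (x : B * C) (a : A) : B * C := (ract x.1 a, ract x.2 a).

Fact pair_ractA b a a' : pair_ract (pair_ract b a) a' = pair_ract b (a * a').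
Proof. by rewrite /pair_ract /= !ractA. Qed.
Fact pair_ract1 b : pair_ract b 1 = b.
Proof. by case: b => b c; rewrite /pair_ract /= !ract1. Qed.
Fact pair_ractDl b b' a : pair_ract (b + b') a = pair_ract b a + pair_ract b' a.
Proof. by rewrite /pair_ract /= !ractDl. Qed.
Fact pair_ractDr b a a' : pair_ract b (a + a') = pair_ract b a + pair_ract b a'.
Proof. by rewrite /pair_ract /= !ractDr. Qed.
Fact pair_ractZ a b a' : pair_ract (a *: b) a' = a *: pair_ract b a'.
Proof. by rewrite /pair_ract /= !ractZ. Qed.

HB.instance Definition _ := Lmodule_isBimodule.Build A (B * C)%type
  pair_ractA pair_ract1 pair_ractDl pair_ractDr pair_ractZ.

End DirectSumBimodule.

Section Tensor.
Context (A : pzRingType) (B : bimodType A) (C : lmodType A).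

Inductive tensor_relator : set {freeg (B * C)%type} :=
| tensor_relDl b b' c :
    tensor_relator (<< (b + b', c) >> - (<< (b, c) >> + << (b', c) >>))
| tensor_relDr b c c' :
    tensor_relator (<< (b, c + c') >> - (<< (b, c) >> + << (b, c') >>))
| tensor_relA b a c :
    tensor_relator (<< (ract b a, c) >> - << (b, a *: c) >>).

Definition tensor : Type := Quotient.quot (subgroup_gen tensor_relator).
HB.instance Definition _ := GRing.Zmodule.on tensor.

Definition tproj : {freeg (B * C)%type} -> tensor :=
  \pi_(Quotient.quot (subgroup_gen tensor_relator)).

Lemma tproj_is_zmod_morphism : zmod_morphism tproj.
Proof. by move=> x y; rewrite /tproj !piE. Qed.

HB.instance Definition _ := GRing.isZmodMorphism.Build
  {freeg (B * C)%type} tensor tproj tproj_is_zmod_morphism.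

Lemma tprojP x y :
  tproj x = tproj y <-> x - y \in subgroup_gen tensor_relator.
Proof.
rewrite /tproj; split.
  by move/eqP; rewrite -Quotient.idealrBE.
by rewrite Quotient.idealrBE => /eqP.
Qed.

Definition tens (b : B) (c : C) : tensor := tproj << (b, c) >>.

Lemma tensDl b b' c : tens (b + b') c = tens b c + tens b' c.
Proof.
rewrite /tens -raddfD; apply/tprojP/subgroup_gen_sub; exact: tensor_relDl.
Qed.

Lemma tensDr b c c' : tens b (c + c') = tens b c + tens b c'.
Proof.
rewrite /tens -raddfD; apply/tprojP/subgroup_gen_sub; exact: tensor_relDr.
Qed.

Lemma tensA b a c : tens (ract b a) c = tens b (a *: c).
Proof. by apply/tprojP/subgroup_gen_sub; exact: tensor_relA. Qed.

Lemma tensor_ind (P : tensor -> Prop) :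
  P 0 -> (forall x y, P x -> P y -> P (x - y)) ->
  (forall b c, P (tens b c)) -> forall t, P t.
Proof.
move=> P0 PB Pt t.
have PN x : P x -> P (- x) by move=> Px; rewrite -sub0r; apply: PB.
have PD x y : P x -> P y -> P (x + y).
  by move=> Px /PN; rewrite -[in P (_ + _)](opprK y); apply: PB.
have PMn x m : P x -> P (x *+ m).
  by move=> Px; elim: m => [|m IH]; rewrite ?mulr0n // mulrS; apply: PD.
have -> : t = tproj (repr (t : Quotient.quot (subgroup_gen tensor_relator))).
  by rewrite /tproj reprK.
rewrite -[repr _]freeg_sumE raddf_sum; apply: (big_ind P) => // -[b c] _.
have -> : forall k : int, << k *g (b, c) >> = << (b, c) >> *~ k.
  by move=> k; rewrite freegU_mulz intz.
rewrite raddfMz; case: (coeff _ _) => m; last first.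
  by rewrite NegzE mulrNz; apply: PN; apply: PMn; apply: Pt.
by apply: PMn; apply: Pt.
Qed.

Section Lift.
Context (G : zmodType).

(* Meaningful only when [h] is balanced. *)
Definition tlift (h : B -> C -> G) (t : tensor) : G :=
  fglift (fun p => h p.1 p.2 : zmodule G)
    (repr (t : Quotient.quot (subgroup_gen tensor_relator))).

Definition balanced (h : B -> C -> G) : Prop :=
  [/\ forall b b' c, h (b + b') c = h b c + h b' c,
      forall b c c', h b (c + c') = h b c + h b c' &
      forall b a c, h (ract b a) c = h b (a *: c)].

Context (h : B -> C -> G) (hP : balanced h).
Let l : {freeg (B * C)%type} -> zmodule G :=
  fglift (fun p => h p.1 p.2 : zmodule G).

Let lB : {morph l : x y / x - y}.
Proof. exact: (@lift_is_additive int _ (zmodule G) _). Qed.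

Let l0 : l 0 = 0.
Proof. by rewrite -(subrr 0) lB subrr. Qed.

Let lD : {morph l : x y / x + y}.
Proof. by move=> x y; rewrite -{1}(opprK y) -(sub0r y) !lB l0 sub0r opprK. Qed.

Let l1 b c : l << (b, c) >> = h b c.
Proof. by rewrite /l liftU scale1r. Qed.

Lemma tlift_proj x : tlift h (tproj x) = l x.
Proof.
suff H z : z \in subgroup_gen tensor_relator -> l z = 0.
  apply/eqP; rewrite -subr_eq0; apply/eqP; rewrite /tlift -lB; apply: H.
  by apply/tprojP; rewrite /tproj reprK.
apply: (@subgroup_gen_min _ _ [set z | l z = 0]) => [|_ []] /=.
- by split=> [//|u v /= Hu Hv]; rewrite lB Hu Hv subrr.
- by move=> b b' c; rewrite lB lD !l1; case: hP => -> *; rewrite subrr.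
- by move=> b c c'; rewrite lB lD !l1; case: hP => _ -> _; rewrite subrr.
- by move=> b a c; rewrite lB !l1; case: hP => _ _ ->; rewrite subrr.
Qed.

Lemma tlift_tens b c : tlift h (tens b c) = h b c.
Proof. by rewrite tlift_proj l1. Qed.

Lemma tliftB : {morph tlift h : x y / x - y}.
Proof.
move=> x y; have [u ->] : exists u, x = tproj u.
  by exists (repr (x : (Quotient.quot _))); rewrite /tproj reprK.
have [v ->] : exists u, y = tproj u.
  by exists (repr (y : (Quotient.quot _))); rewrite /tproj reprK.
by rewrite -raddfB !tlift_proj lB.
Qed.

Lemma tlift0 : tlift h 0 = 0.
Proof. by rewrite -[X in tlift h X](subrr 0) tliftB subrr. Qed.

Lemma tliftD : {morph tlift h : x y / x + y}.
Proof.
by move=> x y; rewrite -{1}(opprK y) -(sub0r y) !tliftB tlift0 sub0r opprK.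
Qed.

End Lift.

Definition tscale (a : A) : tensor -> tensor :=
  tlift (fun b c => tens (a *: b) c).

Lemma tscale_balanced a : balanced (fun b c => tens (a *: b) c).
Proof.
split=> *; first by rewrite scalerDr tensDl.
  by rewrite tensDr.
by rewrite -ractZ tensA.
Qed.

Let tscale_tens a b c : tscale a (tens b c) = tens (a *: b) c.
Proof. by rewrite /tscale (tlift_tens (tscale_balanced a)). Qed.

Let tscaleB a : {morph tscale a : x y / x - y}.
Proof. exact: (tliftB (tscale_balanced a)). Qed.

Let tscale0 a : tscale a 0 = 0.
Proof. exact: (tlift0 (tscale_balanced a)). Qed.

Fact tscaleA a a' t : tscale a (tscale a' t) = tscale (a * a') t.
Proof.
elim/tensor_ind: t => [|x y Hx Hy|b c]; first by rewrite !tscale0.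
  by rewrite !tscaleB Hx Hy.
by rewrite !tscale_tens scalerA.
Qed.
Fact tscale1 : left_id 1 tscale.
Proof.
elim/tensor_ind => [|x y Hx Hy|b c]; first by rewrite !tscale0.
  by rewrite !tscaleB Hx Hy.
by rewrite !tscale_tens scale1r.
Qed.
Fact tscaleDr : right_distributive tscale +%R.
Proof. by move=> a; apply: (tliftD (tscale_balanced a)). Qed.
Fact tscaleDl t : {morph tscale^~ t : a a' / a + a'}.
Proof.
move=> a a'; elim/tensor_ind: t => [|x y Hx Hy|b c].
- by rewrite !tscale0 addr0.
- by rewrite !tscaleB Hx Hy opprD addrACA.
by rewrite !tscale_tens scalerDl tensDl.
Qed.

HB.instance Definition _ := GRing.Zmodule_isLmodule.Build A tensor
  tscaleA tscale1 tscaleDr tscaleDl.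

Lemma tensZ a b c : a *: tens b c = tens (a *: b) c.
Proof. exact: tscale_tens. Qed.

Lemma tensBr b c c' : tens b (c - c') = tens b c - tens b c'.
Proof. by apply: (addIr (tens b c')); rewrite -tensDr !subrK. Qed.

End Tensor.

Section TensorAlgebra.
Context (A : pzRingType) (B : bimodType A).

(* [tpow n] is B (x)_A (B (x)_A ... (B (x)_A A)), with n factors B; the final
   factor A makes degree 0 equal to A, and B is degree 1 through b |-> b (x) 1. *)
Fixpoint tpow (n : nat) : lmodType A :=
  if n is n'.+1 then tensor B (tpow n') else A^o.

Fixpoint tmul (m n : nat) : tpow m -> tpow n -> tpow (m + n) :=
  match m return tpow m -> tpow n -> tpow (m + n) with
  | 0 => fun (a : A) y => a *: y
  | m'.+1 => fun x y => tlift (fun b x' => tens b (tmul x' y)) x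
  end.

Record tensor_alg : Type := TensorAlg {
  tcomp :> forall n, tpow n;
  tcomp_fin : exists N, forall n, (N <= n)%N -> tcomp n = 0
}.

Lemma tensor_alg_ext (x y : tensor_alg) : (forall n, x n = y n) -> x = y.
Proof.
case: x y => x Hx [y Hy] /= E.
have {}E : x = y by apply: functional_extensionality_dep.
by case: _ / E Hy => Hy; congr TensorAlg; apply: Prop_irrelevance.
Qed.

HB.instance Definition _ := gen_eqMixin tensor_alg.
HB.instance Definition _ := gen_choiceMixin tensor_alg.

Fact ta_zero_fin : exists N, forall n, (N <= n)%N -> (0 : tpow n) = 0.
Proof. by exists 0%N. Qed.
Definition ta_zero := TensorAlg ta_zero_fin.

Fact ta_opp_fin (x : tensor_alg) :
  exists N, forall n, (N <= n)%N -> - x n = 0.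
Proof. by case: x => x [N H]; exists N => n /H /= ->; rewrite oppr0. Qed.
Definition ta_opp x := TensorAlg (ta_opp_fin x).

Fact ta_add_fin (x y : tensor_alg) :
  exists N, forall n, (N <= n)%N -> x n + y n = 0.
Proof.
case: x y => x [N H] [y [N' H']]; exists (maxn N N') => n /=.
by rewrite geq_max => /andP[/H -> /H' ->]; rewrite addr0.
Qed.
Definition ta_add x y := TensorAlg (ta_add_fin x y).

Fact ta_addA : associative ta_add.
Proof. by move=> x y z; apply: tensor_alg_ext => n /=; rewrite addrA. Qed.
Fact ta_addC : commutative ta_add.
Proof. by move=> x y; apply: tensor_alg_ext => n /=; rewrite addrC. Qed.
Fact ta_add0 : left_id ta_zero ta_add.
Proof. by move=> x; apply: tensor_alg_ext => n /=; rewrite add0r. Qed.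
Fact ta_addN : left_inverse ta_zero ta_opp ta_add.
Proof. by move=> x; apply: tensor_alg_ext => n /=; rewrite addNr. Qed.

HB.instance Definition _ :=
  GRing.isZmodule.Build tensor_alg ta_addA ta_addC ta_add0 ta_addN.

Fact thom_fin n (v : tpow n) : exists N, forall k, (N <= k)%N ->
  dfwith (fun k => 0 : tpow k) v k = 0.
Proof. by exists n.+1 => k nk; rewrite dfwith_out // ltn_eqF. Qed.
Definition thom n (v : tpow n) := TensorAlg (thom_fin v).

Lemma tcompD (x y : tensor_alg) n : (x + y) n = x n + y n. Proof. by []. Qed.
Lemma tcompB (x y : tensor_alg) n : (x - y) n = x n - y n. Proof. by []. Qed.
Lemma tcomp0 n : (0 : tensor_alg) n = 0. Proof. by []. Qed.

Lemma tcomp_sum I (r : seq I) (P : pred I) (F : I -> tensor_alg) n :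
  (\sum_(i <- r | P i) F i) n = \sum_(i <- r | P i) F i n.
Proof. exact: (big_morph (fun x : tensor_alg => x n)). Qed.

Lemma thomB n : {morph @thom n : x y / x - y}.
Proof.
move=> x y; apply: tensor_alg_ext => k; rewrite tcompB /=.
case: (eqVneq n k) => [<-|nk]; first by rewrite !dfwith_in.
by rewrite !dfwith_out // subr0.
Qed.

HB.instance Definition _ n :=
  GRing.isZmodMorphism.Build (tpow n) tensor_alg (@thom n) (@thomB n).

Definition tbound (x : tensor_alg) : nat := projT1 (cid (tcomp_fin x)).

Lemma tboundP (x : tensor_alg) n : (tbound x <= n)%N -> x n = 0.
Proof. by rewrite /tbound; case: cid => N /= H /H. Qed.

Lemma tcomp_decomp (x : tensor_alg) N :
  (forall n, (N <= n)%N -> x n = 0) -> x = \sum_(i < N) thom (x i).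
Proof.
move=> xN; apply: tensor_alg_ext => k; rewrite tcomp_sum /=.
case: (ltnP k N) => [kN|Nk].
  rewrite (bigD1 (Ordinal kN)) //= dfwith_in big1 ?addr0 // => i ik.
  by rewrite dfwith_out //; apply: contra_neq ik => ik; apply: val_inj.
rewrite xN // big1 // => i _; rewrite dfwith_out //.
by rewrite ltn_eqF // (leq_trans (ltn_ord i)).
Qed.

Definition ta_mul (x y : tensor_alg) : tensor_alg :=
  \sum_(i < tbound x) \sum_(j < tbound y) thom (tmul (x i) (y j)).

Definition ta_one : tensor_alg := @thom 0 (1 : A).

Lemma tmul_linl_balanced m n (y : tpow n) :
  (forall (x x' : tpow m), tmul (x - x') y = tmul x y - tmul x' y) ->
  (forall a (x : tpow m), tmul (a *: x) y = a *: tmul x y) ->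
  balanced (fun (b : B) (x' : tpow m) => tens b (tmul x' y)).
Proof.
move=> HB HZ.
have H0 : tmul (0 : tpow m) y = 0 by rewrite -(subrr 0) HB subrr.
split=> [b b' c|b c c'|b a c]; first by rewrite tensDl.
  by rewrite -{1}(opprK c') HB -(sub0r c') HB H0 sub0r opprK tensDr.
by rewrite HZ tensA.
Qed.

Lemma tmul_linl m n (y : tpow n) :
  (forall (x x' : tpow m), tmul (x - x') y = tmul x y - tmul x' y) /\
  (forall a (x : tpow m), tmul (a *: x) y = a *: tmul x y).
Proof.
elim: m => [|m [IHB IHZ]].
  by split=> [x x'|a x]; [apply: scalerBl|symmetry; apply: scalerA].
have bal := tmul_linl_balanced IHB IHZ.
split=> [|a]; first exact: (tliftB bal).
elim/tensor_ind => [|u v Hu Hv|b c].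
- by rewrite scaler0 /= (tlift0 bal) scaler0.
- by rewrite scalerBr /= !(tliftB bal) /= scalerBr -[in RHS]Hu -[in RHS]Hv.
by rewrite tensZ /= !(tlift_tens bal) tensZ.
Qed.

Lemma tmulBl m n (x x' : tpow m) (y : tpow n) :
  tmul (x - x') y = tmul x y - tmul x' y.
Proof. exact: (tmul_linl _ _).1. Qed.

Lemma tmulZl m n a (x : tpow m) (y : tpow n) :
  tmul (a *: x) y = a *: tmul x y.
Proof. exact: (tmul_linl _ _).2. Qed.

Lemma tmul_balanced m n (y : tpow n) :
  balanced (fun (b : B) (x' : tpow m) => tens b (tmul x' y)).
Proof. by apply: tmul_linl_balanced => *; rewrite (tmulBl, tmulZl). Qed.

Lemma tmul_tens m n (b : B) (x : tpow m) (y : tpow n) :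
  tmul (tens b x : tpow m.+1) y = tens b (tmul x y).
Proof. by rewrite /= (tlift_tens (tmul_balanced m y)). Qed.

Lemma tmul0l m n (y : tpow n) : tmul (0 : tpow m) y = 0.
Proof. by rewrite -(subrr 0) tmulBl subrr. Qed.

Lemma tmulBr m n (x : tpow m) (y y' : tpow n) :
  tmul x (y - y') = tmul x y - tmul x y'.
Proof.
elim: m x => [|m IH] x; first exact: scalerBr.
elim/tensor_ind: x => [|u v Hu Hv|b c].
- by rewrite !tmul0l subr0.
- by rewrite !tmulBl Hu Hv !opprB addrACA [in RHS]addrACA [- _ + _]addrC.
by rewrite !tmul_tens IH tensBr.
Qed.

Lemma tmul0r m n (x : tpow m) : tmul x (0 : tpow n) = 0.
Proof. by rewrite -(subrr 0) tmulBr subrr. Qed.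

Lemma ecast_tpow_tens n m (b : B) (x : tpow n) (e : n = m) (e' : n.+1 = m.+1) :
  ecast k (tpow k) e' (tens b x : tpow n.+1) = tens b (ecast k (tpow k) e x).
Proof. by case: _ / e e' => e'; rewrite (eq_axiomK e'). Qed.

Lemma ecast_tpowB n m (x y : tpow n) (e : n = m) :
  ecast k (tpow k) e (x - y) = ecast k (tpow k) e x - ecast k (tpow k) e y.
Proof. by case: _ / e. Qed.

Lemma thom_ecast n m (x : tpow n) (e : n = m) :
  thom (ecast k (tpow k) e x) = thom x.
Proof. by case: _ / e. Qed.

Lemma tmulA i j k (x : tpow i) (y : tpow j) (z : tpow k) :
  ecast n (tpow n) (esym (addnA i j k)) (tmul (tmul x y) z) =
  tmul x (tmul y z).
Proof.
move: (esym _); elim: i x => [|i IH] x e.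
  by rewrite (eq_axiomK e) /= tmulZl.
elim/tensor_ind: x => [|u v Hu Hv|b c].
- rewrite !tmul0l; apply: (addIr (ecast n (tpow n) e 0)).
  by rewrite add0r -{1}(subrr 0) ecast_tpowB subrK.
- by rewrite !tmulBl ecast_tpowB Hu Hv.
rewrite !tmul_tens.
have e' : (i + j + k = i + (j + k))%N by rewrite addnA.
by rewrite (ecast_tpow_tens _ _ e') IH.
Qed.

Lemma tmul1 n (x : tpow n) :
  ecast k (tpow k) (addn0 n) (tmul x (1 : tpow 0)) = x.
Proof.
move: (addn0 n); elim: n x => [|n IH] x e.
  by rewrite (eq_axiomK e) /=; apply: mulr1.
elim/tensor_ind: x => [|u v Hu Hv|b c].
- rewrite tmul0l; apply: (addIr (ecast n (tpow n) e 0)).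
  by rewrite add0r -{1}(subrr 0) ecast_tpowB subrK.
- by rewrite !tmulBl ecast_tpowB Hu Hv.
by rewrite tmul_tens (ecast_tpow_tens _ _ (addn0 n)) IH.
Qed.

Lemma ta_mulE (x y : tensor_alg) N M :
  (forall n, (N <= n)%N -> x n = 0) -> (forall n, (M <= n)%N -> y n = 0) ->
  ta_mul x y = \sum_(i < N) \sum_(j < M) thom (tmul (x i) (y j)).
Proof.
move=> xN yM.
have widen (F : nat -> tensor_alg) N1 N2 :
    (forall n, (N1 <= n)%N -> F n = 0) -> (forall n, (N2 <= n)%N -> F n = 0) ->
    \sum_(i < N1) F i = \sum_(i < N2) F i.
  wlog le : N1 N2 / (N1 <= N2)%N.
    by move=> H F1 F2; case: (leqP N1 N2) => [|/ltnW] /H ->.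
  move=> F1 F2; rewrite (big_ord_widen N2 F le).
  rewrite [RHS](bigID (fun i : 'I_N2 => (i < N1)%N)) /=.
  by rewrite [X in _ = _ + X]big1 ?addr0 // => i; rewrite -leqNgt => /F1.
rewrite /ta_mul.
rewrite (widen (fun i => \sum_(j < tbound y) thom (tmul (x i) (y j))) _ N).
- apply: eq_bigr => i _.
  apply: (widen (fun j => thom (tmul (x i) (y j)))) => n Hn.
    by rewrite (@tboundP y n Hn) tmul0r raddf0.
  by rewrite (yM n Hn) tmul0r raddf0.
- by move=> n Hn; rewrite (@tboundP x n Hn) big1 // => j _; rewrite tmul0l raddf0.
- by move=> n Hn; rewrite xN // big1 // => j _; rewrite tmul0l raddf0.
Qed.

Lemma ta_mulBl x x' y : ta_mul (x - x') y = ta_mul x y - ta_mul x' y.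
Proof.
pose N := maxn (tbound x) (tbound x').
have xN n : (N <= n)%N -> x n = 0.
  by rewrite geq_max => /andP[/tboundP].
have x'N n : (N <= n)%N -> x' n = 0.
  by rewrite geq_max => /andP[_ /tboundP].
have dN n : (N <= n)%N -> (x - x') n = 0.
  by move=> Hn; rewrite tcompB xN // x'N // subr0.
rewrite (ta_mulE dN (@tboundP y)) (ta_mulE xN (@tboundP y)).
rewrite (ta_mulE x'N (@tboundP y)) -sumrB; apply: eq_bigr => i _.
by rewrite -sumrB; apply: eq_bigr => j _; rewrite tcompB tmulBl raddfB.
Qed.

Lemma ta_mulBr x y y' : ta_mul x (y - y') = ta_mul x y - ta_mul x y'.
Proof.
pose N := maxn (tbound y) (tbound y').
have yN n : (N <= n)%N -> y n = 0.
  by rewrite geq_max => /andP[/tboundP].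
have y'N n : (N <= n)%N -> y' n = 0.
  by rewrite geq_max => /andP[_ /tboundP].
have dN n : (N <= n)%N -> (y - y') n = 0.
  by move=> Hn; rewrite tcompB yN // y'N // subr0.
rewrite (ta_mulE (@tboundP x) dN) (ta_mulE (@tboundP x) yN).
rewrite (ta_mulE (@tboundP x) y'N) -sumrB; apply: eq_bigr => i _.
by rewrite -sumrB; apply: eq_bigr => j _; rewrite tcompB tmulBr raddfB.
Qed.

Lemma ta_mul0l y : ta_mul 0 y = 0.
Proof. by rewrite -[X in ta_mul X y](subrr 0) ta_mulBl subrr. Qed.

Lemma ta_mul0r x : ta_mul x 0 = 0.
Proof. by rewrite -[X in ta_mul x X](subrr 0) ta_mulBr subrr. Qed.

Fact ta_mulDl : left_distributive ta_mul +%R.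
Proof.
move=> x x' y; rewrite -{1}(opprK x') -(sub0r x') !ta_mulBl ta_mul0l.
by rewrite sub0r opprK.
Qed.

Fact ta_mulDr : right_distributive ta_mul +%R.
Proof.
move=> x y y'; rewrite -{1}(opprK y') -(sub0r y') !ta_mulBr ta_mul0r.
by rewrite sub0r opprK.
Qed.

Lemma thom_out n (v : tpow n) k : (n.+1 <= k)%N -> thom v k = 0.
Proof. by move=> nk; rewrite /= dfwith_out // ltn_eqF. Qed.

Lemma ta_mul_hom m n (x : tpow m) (y : tpow n) :
  ta_mul (thom x) (thom y) = thom (tmul x y).
Proof.
rewrite (ta_mulE (@thom_out _ x) (@thom_out _ y)).
rewrite big_ord_recr /= big1 ?add0r => [|i _]; last first.
  rewrite big1 // => j _.
  by rewrite (@dfwith_out _ _ _ m x i) ?tmul0l ?raddf0 // gtn_eqF.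
rewrite big_ord_recr /= big1 ?add0r => [|j _]; last first.
  by rewrite (@dfwith_out _ _ _ n y j) ?tmul0r ?raddf0 // gtn_eqF.
by rewrite !dfwith_in.
Qed.

Lemma tensor_alg_ind (P : tensor_alg -> Prop) :
  P 0 -> (forall x y, P x -> P y -> P (x + y)) ->
  (forall n (v : tpow n), P (thom v)) -> forall x, P x.
Proof.
move=> P0 PD Ph x; rewrite (tcomp_decomp (@tboundP x)).
by apply: (big_ind P) => // i _; apply: Ph.
Qed.

Fact ta_mulA : associative ta_mul.
Proof.
move=> x y z; elim/tensor_alg_ind: x => [|x x' Hx Hx'|i u].
- by rewrite !ta_mul0l.
- by rewrite !ta_mulDl Hx Hx'.
elim/tensor_alg_ind: y => [|y y' Hy Hy'|j v].
- by rewrite !(ta_mul0l, ta_mul0r).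
- by rewrite !(ta_mulDl, ta_mulDr) Hy Hy'.
elim/tensor_alg_ind: z => [|z z' Hz Hz'|k w].
- by rewrite !ta_mul0r.
- by rewrite !ta_mulDr Hz Hz'.
by rewrite !ta_mul_hom -tmulA thom_ecast.
Qed.

Fact ta_mul1l : left_id ta_one ta_mul.
Proof.
move=> x; elim/tensor_alg_ind: x => [|x y Hx Hy|n v].
- by rewrite ta_mul0r.
- by rewrite ta_mulDr Hx Hy.
by rewrite ta_mul_hom /= scale1r.
Qed.

Fact ta_mul1r : right_id ta_one ta_mul.
Proof.
move=> x; elim/tensor_alg_ind: x => [|x y Hx Hy|n v].
- by rewrite ta_mul0l.
- by rewrite ta_mulDl Hx Hy.
by rewrite ta_mul_hom -[in RHS](tmul1 v) thom_ecast.
Qed.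

HB.instance Definition _ := GRing.Zmodule_isPzRing.Build tensor_alg
  ta_mulA ta_mul1l ta_mul1r ta_mulDl ta_mulDr.

Definition tgen0 (a : A) : tensor_alg := @thom 0 a.
Definition tgen1 (b : B) : tensor_alg := @thom 1 (tens b (1 : A^o)).

End TensorAlgebra.

Definition restr (R S : comPzRingType) (phi : {rmorphism R -> S}) : Type := S.

Section Restr.
Context (R S : comPzRingType) (phi : {rmorphism R -> S}).

HB.instance Definition _ := GRing.ComPzRing.on (restr phi).

Definition restr_scale (r : R) (x : restr phi) : restr phi := phi r * x.

Fact restr_scaleA r r' x :
  restr_scale r (restr_scale r' x) = restr_scale (r * r') x.
Proof. by rewrite /restr_scale rmorphM mulrA. Qed.
Fact restr_scale1 : left_id 1 restr_scale.
Proof. by move=> x; rewrite /restr_scale rmorph1 mul1r. Qed.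
Fact restr_scaleDr : right_distributive restr_scale +%R.
Proof. by move=> r x y; rewrite /restr_scale mulrDr. Qed.
Fact restr_scaleDl x : {morph restr_scale^~ x : r r' / r + r'}.
Proof. by move=> r r'; rewrite /restr_scale rmorphD mulrDl. Qed.

HB.instance Definition _ := GRing.Zmodule_isLmodule.Build R (restr phi)
  restr_scaleA restr_scale1 restr_scaleDr restr_scaleDl.

End Restr.

Definition is_basis (R : pzRingType) (V : lmodType R) (n : nat)
    (e : 'I_n -> V) : Prop :=
  forall x, exists! c : {ffun 'I_n -> R}, x = \sum_i c i *: e i.

Section Frobenius.
Context (R S : comPzRingType) (phi : {rmorphism R -> S}).

Definition dual : Type := {linear restr phi -> R^o}.

(* [Phi] is an isomorphism of S-modules S -> Hom_R(S, R), where S acts on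
   Hom_R(S, R) by (s . l) x = l (s * x). *)
Definition dual_iso (Phi : S -> dual) : Prop :=
  [/\ forall s t x, Phi (s + t) x = Phi s x + Phi t x,
      forall s t x, Phi (s * t) x = Phi t (s * x),
      forall s t, Phi s =1 Phi t -> s = t &
      forall l : dual, exists s, Phi s =1 l].

Definition relative_frobenius (n : nat) : Prop :=
  (exists e : 'I_n -> restr phi, is_basis e) /\ (exists Phi, dual_iso Phi).

Definition dual_generator (lambda : dual) : Prop :=
  forall l : dual, exists s : S, forall x, l x = lambda (s * x).

Definition dual_bases (lambda : dual) (n : nat)
    (e f : 'I_n -> restr phi) : Prop :=
  [/\ is_basis e, is_basis f &
      forall i j, lambda (e i * f j) = (i == j)%:R].

End Frobenius.

Section Bimodules.
Context (R S : comPzRingType) (phi : {rmorphism R -> S}).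
Local Notation RS := (R * S)%type.

Definition bimodM of {rmorphism R -> S} : Type := S.
Definition bimodN of {rmorphism R -> S} : Type := S.

HB.instance Definition _ := GRing.Zmodule.on (bimodM phi).
HB.instance Definition _ := GRing.Zmodule.on (bimodN phi).

(* On M, R acts on the left and S on the right; on N it is the reverse. The
   remaining component of [a : R * S] acts by zero, so it does not occur. *)
Definition M_lact (a : RS) (x : bimodM phi) : bimodM phi := phi a.1 * (x : S).
Definition M_ract (x : bimodM phi) (a : RS) : bimodM phi := (x : S) * a.2.
Definition N_lact (a : RS) (x : bimodN phi) : bimodN phi := a.2 * (x : S).
Definition N_ract (x : bimodN phi) (a : RS) : bimodN phi := (x : S) * phi a.1.

Fact M_lactA a b x : M_lact a (M_lact b x) = M_lact (a * b) x.
Proof. by rewrite /M_lact rmorphM mulrA. Qed.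
Fact M_lact1 : left_id 1 M_lact.
Proof. by move=> x; rewrite /M_lact rmorph1 mul1r. Qed.
Fact M_lactDr : right_distributive M_lact +%R.
Proof. by move=> a x y; rewrite /M_lact mulrDr. Qed.
Fact M_lactDl x : {morph M_lact^~ x : a b / a + b}.
Proof. by move=> a b; rewrite /M_lact rmorphD mulrDl. Qed.
HB.instance Definition _ := GRing.Zmodule_isLmodule.Build RS (bimodM phi)
  M_lactA M_lact1 M_lactDr M_lactDl.

Fact M_ractA x a b : M_ract (M_ract x a) b = M_ract x (a * b).
Proof. by rewrite /M_ract mulrA. Qed.
Fact M_ract1 x : M_ract x 1 = x.
Proof. by rewrite /M_ract mulr1. Qed.
Fact M_ractDl x y a : M_ract (x + y) a = M_ract x a + M_ract y a.
Proof. by rewrite /M_ract mulrDl. Qed.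
Fact M_ractDr x a b : M_ract x (a + b) = M_ract x a + M_ract x b.
Proof. by rewrite /M_ract mulrDr. Qed.
Fact M_ractZ a x b : M_ract (a *: x) b = a *: M_ract x b.
Proof. by rewrite /M_ract [RHS]mulrA. Qed.
HB.instance Definition _ := Lmodule_isBimodule.Build RS (bimodM phi)
  M_ractA M_ract1 M_ractDl M_ractDr M_ractZ.

Fact N_lactA a b x : N_lact a (N_lact b x) = N_lact (a * b) x.
Proof. by rewrite /N_lact mulrA. Qed.
Fact N_lact1 : left_id 1 N_lact.
Proof. by move=> x; rewrite /N_lact mul1r. Qed.
Fact N_lactDr : right_distributive N_lact +%R.
Proof. by move=> a x y; rewrite /N_lact mulrDr. Qed.
Fact N_lactDl x : {morph N_lact^~ x : a b / a + b}.
Proof. by move=> a b; rewrite /N_lact mulrDl. Qed.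
HB.instance Definition _ := GRing.Zmodule_isLmodule.Build RS (bimodN phi)
  N_lactA N_lact1 N_lactDr N_lactDl.

Fact N_ractA x a b : N_ract (N_ract x a) b = N_ract x (a * b).
Proof. by rewrite /N_ract rmorphM mulrA. Qed.
Fact N_ract1 x : N_ract x 1 = x.
Proof. by rewrite /N_ract rmorph1 mulr1. Qed.
Fact N_ractDl x y a : N_ract (x + y) a = N_ract x a + N_ract y a.
Proof. by rewrite /N_ract mulrDl. Qed.
Fact N_ractDr x a b : N_ract x (a + b) = N_ract x a + N_ract x b.
Proof. by rewrite /N_ract rmorphD mulrDr. Qed.
Fact N_ractZ a x b : N_ract (a *: x) b = a *: N_ract x b.
Proof. by rewrite /N_ract [RHS]mulrA. Qed.
HB.instance Definition _ := Lmodule_isBimodule.Build RS (bimodN phi)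
  N_ractA N_ract1 N_ractDl N_ractDr N_ractZ.

End Bimodules.

Section Preprojective.
Context (R S : comPzRingType) (phi : {rmorphism R -> S}).

Definition TRS : pzRingType := tensor_alg (bimodM phi * bimodN phi)%type.

Definition genM (s : S) : TRS := tgen1 ((s : bimodM phi), (0 : bimodN phi)).
Definition genN (s : S) : TRS := tgen1 ((0 : bimodM phi), (s : bimodN phi)).

Context (n : nat) (e f : 'I_n -> restr phi).

(* In degree 2 the product of [genM s] and [genN t] is the tensor s (x) t. *)
Inductive preproj_relator : set TRS :=
| preproj_relR : preproj_relator (genM 1 * genN 1)
| preproj_relS : preproj_relator (\sum_i genN (e i) * genM (f i)).

Definition preproj : pzRingType := quot_ring preproj_relator.

End Preprojective.

Arguments preproj {R S} phi {n} e f.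

(* Main.v *)
From HB Require Import structures.
Require Import Defs.
From mathcomp Require Import all_boot all_algebra.
From mathcomp Require Import ring.

(* Write [x = b a] for the loop at the vertex S and [u_s = a s b] for the loops
   at the vertex R. The quadratic elements
     w(s) = s x s x + x s x s + x (s^2 - tr(s) s) x
   commute with S, so that [z(s) = u_s^2 + w(s)] is central: the relation
   [a b = 0] gives [a w(s) = u_s^2 a] and [w(s) b = b u_s^2]. Over the
   ring of the [z(s)], the loops [u_s] generate a Clifford algebra, hence the
   preprojective algebra is a finite module over the ring generated by R and
   finitely many [z(s)], which is noetherian by Hilbert's basis theorem.

   For the commutation, [t w(s) - w(s) t] is expressed through
   [K(v, y, w) = v x y x w - w x y x v], which is alternating in v and w and is
   killed by contraction with the dual bases. The Koszul complex of a basis of S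
   is exact, so K is the contraction of the volume form of S with a bilinear
   form kappa, symmetric because [K(v, 1, w) = 0]. As multiplication by s acts on
   the volume form by its trace, [t w(s) - w(s) t] becomes the pairing of kappa
   with an alternating form. *)

Set Implicit Arguments.
Unset Strict Implicit.
Unset Printing Implicit Defensive.

Import GRing.Theory.
Local Open Scope ring_scope.

(** * Maps from an R-module to a ring that are linear along a ring morphism *)

Section LinearOver.
Context (R A : pzRingType) (iota : {rmorphism R -> A}) (V : lmodType R).

(** [A] carries no declared R-module structure; scalars act by left multiplication through
    [iota]. *)
Definition linear_over (h : V -> A) : Prop :=
  forall r u v, h (r *: u + v) = iota r * h u + h v.

Context (h : V -> A) (hL : linear_over h).

Lemma linear_overD : {morph h : u v / u + v}.
Proof. by move=> u v; have := hL 1 u v; rewrite scale1r rmorph1 mul1r. Qed.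

Lemma linear_over0 : h 0 = 0.
Proof. by apply: (addIr (h 0)); rewrite -linear_overD !add0r. Qed.

Lemma linear_overZ r u : h (r *: u) = iota r * h u.
Proof. by have := hL r u 0; rewrite linear_over0 !addr0. Qed.

Lemma linear_over_sum (I : finType) (u : I -> V) :
  h (\sum_i u i) = \sum_i h (u i).
Proof. exact: (big_morph h linear_overD linear_over0). Qed.

Lemma linear_over_comb (I : finType) (c : I -> R) (u : I -> V) :
  h (\sum_i c i *: u i) = \sum_i iota (c i) * h (u i).
Proof.
by rewrite linear_over_sum; apply: eq_bigr => i _; rewrite linear_overZ.
Qed.

End LinearOver.

(** * Two-forms in rank four *)

(* The pair (i, j) complementary to (k, l), ordered so that (i, j, k, l) is an
   even permutation of (0, 1, 2, 3); diagonal pairs are fixed (junk). *)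
Definition compl_pair (p : 'I_4 * 'I_4) : 'I_4 * 'I_4 :=
  match val p.1, val p.2 with
  | 0, 1 => (inord 2, inord 3) | 1, 0 => (inord 3, inord 2)
  | 0, 2 => (inord 3, inord 1) | 2, 0 => (inord 1, inord 3)
  | 0, 3 => (inord 1, inord 2) | 3, 0 => (inord 2, inord 1)
  | 1, 2 => (inord 0, inord 3) | 2, 1 => (inord 3, inord 0)
  | 1, 3 => (inord 2, inord 0) | 3, 1 => (inord 0, inord 2)
  | 2, 3 => (inord 0, inord 1) | 3, 2 => (inord 1, inord 0)
  | _, _ => p
  end.

Lemma ord4P (i : 'I_4) :
  [\/ i = inord 0, i = inord 1, i = inord 2 | i = inord 3].
Proof.
case: i => -[|[|[|[|//]]]] Hi;
  [constructor 1|constructor 2|constructor 3|constructor 4];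
  by apply: val_inj; rewrite /= inordK.
Qed.

Lemma sum4 (V : nmodType) (F : 'I_4 -> V) :
  \sum_i F i = F (inord 0) + F (inord 1) + F (inord 2) + F (inord 3).
Proof.
rewrite !big_ord_recr big_ord0 /= add0r.
by congr (_ + _ + _ + _); congr F; apply: val_inj; rewrite /= inordK.
Qed.

Lemma compl_pairE i j : (i < 4)%N -> (j < 4)%N ->
  compl_pair (inord i, inord j) =
  match i, j with
  | 0, 1 => (inord 2, inord 3) | 1, 0 => (inord 3, inord 2)
  | 0, 2 => (inord 3, inord 1) | 2, 0 => (inord 1, inord 3)
  | 0, 3 => (inord 1, inord 2) | 3, 0 => (inord 2, inord 1)
  | 1, 2 => (inord 0, inord 3) | 2, 1 => (inord 3, inord 0)
  | 1, 3 => (inord 2, inord 0) | 3, 1 => (inord 0, inord 2)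
  | 2, 3 => (inord 0, inord 1) | 3, 2 => (inord 1, inord 0)
  | _, _ => (inord i, inord j)
  end.
Proof. by move=> Hi Hj; rewrite /compl_pair /= !inordK. Qed.

Lemma compl_pairK : involutive compl_pair.
Proof.
case=> i j; case: (ord4P i) => ->; case: (ord4P j) => ->;
  by rewrite !compl_pairE.
Qed.

Lemma compl_pair_swap k l :
  compl_pair (l, k) = ((compl_pair (k, l)).2, (compl_pair (k, l)).1).
Proof.
by case: (ord4P k) => ->; case: (ord4P l) => ->; rewrite !compl_pairE.
Qed.

(* Coordinates of the contraction of [v ^ w] with the volume form. *)
Definition wedge_dual (R : pzRingType) (v w : 'I_4 -> R) (k l : 'I_4) : R :=
  v (compl_pair (k, l)).1 * w (compl_pair (k, l)).2
  - v (compl_pair (k, l)).2 * w (compl_pair (k, l)).1.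

(* An endomorphism acts on the volume form, as a derivation, by its trace. *)
Lemma wedge_dual_trace (R : comPzRingType) (M : 'I_4 -> 'I_4 -> R)
    (v w : 'I_4 -> R) k l :
  let act u j := \sum_i u i * M i j in
  wedge_dual (act v) w k l + wedge_dual v (act w) k l
  + \sum_m M k m * wedge_dual v w m l + \sum_m M l m * wedge_dual v w k m =
  (\sum_i M i i) * wedge_dual v w k l.
Proof.
move=> act; rewrite /act.
case: (ord4P k) => ->; case: (ord4P l) => ->;
  rewrite !sum4 /wedge_dual !compl_pairE //= ?sum4; ring.
Qed.

(** * Coordinates with respect to dual bases *)

Section DualBases.
Context (R S : comPzRingType) (phi : {rmorphism R -> S}) (lambda : dual phi).
Context (n : nat) (e f : 'I_n -> restr phi) (ef : dual_bases lambda e f).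
Local Notation V := (restr phi).

Lemma restr_scalerAl (r : R) (x y : V) : r *: x * y = r *: (x * y).
Proof. by rewrite /GRing.scale /= /restr_scale mulrA. Qed.

Lemma restr_scalerAr (r : R) (x y : V) : x * (r *: y) = r *: (x * y).
Proof. by rewrite mulrC restr_scalerAl mulrC. Qed.

Lemma dual_sum (I : finType) (c : I -> R) (u : I -> V) :
  lambda (\sum_i c i *: u i) = \sum_i c i * lambda (u i).
Proof. by rewrite linear_sum; apply: eq_bigr => i _; rewrite linearZ. Qed.

(** Duality makes pairing with [f i] read off the coefficient of [e i]; exchanging the two bases
    gives [expand_right]. *)
Lemma expand_left (y : V) : y = \sum_i (lambda (y * f i) : R) *: e i.
Proof.
case: ef => eB _ efE; have [c [yE _]] := eB y.
rewrite {1}yE; apply: eq_bigr => i _; congr (_ *: _).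
rewrite yE mulr_suml; under eq_bigr do rewrite restr_scalerAl.
rewrite dual_sum (bigD1 i) //= efE eqxx mulr1 big1 ?addr0 // => j ji.
by rewrite efE (negbTE ji) mulr0.
Qed.

Lemma expand_right (y : V) : y = \sum_i (lambda (y * e i) : R) *: f i.
Proof.
case: ef => _ fB efE; have [c [yE _]] := fB y.
rewrite {1}yE; apply: eq_bigr => i _; congr (_ *: _).
rewrite yE mulr_suml; under eq_bigr do rewrite restr_scalerAl mulrC.
rewrite dual_sum (bigD1 i) //= efE eqxx mulr1 big1 ?addr0 // => j ji.
by rewrite efE eq_sym (negbTE ji) mulr0.
Qed.

(** The matrix of multiplication by [s]: row i holds the coordinates of [s * e i] in [e], and column
    j those of [s * f j] in [f]. Its diagonal sum is tr(s). *)
Definition mulmat (s : V) (i j : 'I_n) : R := lambda (s * e i * f j).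

Lemma mulmat_right s j : s * f j = \sum_i mulmat s i j *: f i.
Proof.
by rewrite {1}(expand_right (s * f j)); apply: eq_bigr => i _; rewrite mulrAC.
Qed.

Lemma mulmat_coord s v j :
  lambda (s * v * f j) = \sum_i lambda (v * f i) * mulmat s i j.
Proof.
rewrite {1}(expand_left v) mulr_sumr mulr_suml -dual_sum; congr (lambda _).
by apply: eq_bigr => i _; rewrite restr_scalerAr restr_scalerAl.
Qed.

End DualBases.

(** * The quartic identity for a trilinear map with the formal properties of K *)

Section Quartic.
Context (R S : comPzRingType) (phi : {rmorphism R -> S}) (lambda : dual phi).
Context (e f : 'I_4 -> restr phi) (ef : dual_bases lambda e f).
Context (A : pzRingType) (iota : {rmorphism R -> A}).
Local Notation V := (restr phi).
(** In the application [Kcontr] expresses the Casimir relation at the vertex S, and [Kone] the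
    equality x^2 = 0. *)
Context (K : V -> V -> V -> A).
Hypothesis K1 : forall y w, linear_over iota (fun v => K v y w).
Hypothesis K2 : forall v w, linear_over iota (fun y => K v y w).
Hypothesis K3 : forall v y, linear_over iota (K v y).
Hypothesis Kalt : forall v y, K v y v = 0.
Hypothesis Kcontr : forall y w, \sum_i K (e i) (f i * y) w = 0.
Hypothesis Kone : forall v w, K v 1 w = 0.

Let Kanti v y w : K v y w = - K w y v.
Proof.
apply/eqP; rewrite -addr_eq0; apply/eqP.
have := Kalt (v + w) y.
rewrite (linear_overD (K1 _ _)) !(linear_overD (K3 _ _)).
by rewrite !Kalt add0r addr0.
Qed.

(** The volume form identifies the alternating pair of arguments of K with a 2-form; these are its
    components. *)
Let K' k l y := K (e (compl_pair (k, l)).1) y (e (compl_pair (k, l)).2).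

Let K'anti k l y : K' k l y = - K' l k y.
Proof. by rewrite /K' (compl_pair_swap k l) /= -Kanti. Qed.

Let K'alt k y : K' k k y = 0.
Proof. by case: (ord4P k) => ->; rewrite /K' compl_pairE ?Kalt. Qed.

Let K'L k l : linear_over iota (K' k l). Proof. exact: K2. Qed.

(** The Koszul differential of [K'], that is, its exterior product with the vector of the [f a]. *)
Let Z a k l y := K' k l (f a * y) + K' l a (f k * y) + K' a k (f l * y).

Let Zcyc a k l y : Z a k l y = Z k l a y.
Proof. by rewrite /Z [RHS]addrC addrA. Qed.

Let Zanti a k l y : Z a k l y = - Z a l k y.
Proof.
rewrite /Z (K'anti k l) (K'anti l a) (K'anti a k) !opprD.
by rewrite addrAC.
Qed.

Let Z0 a k y : Z a k k y = 0.
Proof. by rewrite /Z K'alt add0r (K'anti a k) addrN. Qed.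

(** For distinct a, k, l with fourth index m, [Z a k l y] is, up to sign, the contraction of K with
    last argument [e m]: the term i = m vanishes by alternation and the other three are those of
    [Z]. *)
Let K'cocycle a k l y : Z a k l y = 0.
Proof.
have contr := Kcontr y.
have Z012 : Z (inord 0) (inord 1) (inord 2) y = 0.
  by rewrite -(contr (e (inord 3))) sum4 Kalt addr0 /Z /K' !compl_pairE.
have Z013 : Z (inord 0) (inord 1) (inord 3) y = 0.
  apply: oppr_inj; rewrite oppr0 -(contr (e (inord 2))) sum4 Kalt addr0.
  by rewrite /Z /K' !compl_pairE //= !opprD -!Kanti.
have Z023 : Z (inord 0) (inord 2) (inord 3) y = 0.
  by rewrite -(contr (e (inord 1))) sum4 Kalt addr0 /Z /K' !compl_pairE.
have Z123 : Z (inord 1) (inord 2) (inord 3) y = 0.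
  apply: oppr_inj; rewrite oppr0 -(contr (e (inord 0))) sum4 Kalt add0r.
  by rewrite /Z /K' !compl_pairE //= !opprD -!Kanti.
(* Every other triple is a permutation of one of these four or has a repeated index. *)
have Zs i j m : Z i j m y = 0 -> [/\ Z i m j y = 0, Z j i m y = 0,
    Z j m i y = 0, Z m i j y = 0 & Z m j i y = 0].
  move=> H; split; first by rewrite Zanti H oppr0.
  - by rewrite Zanti -Zcyc H oppr0.
  - by rewrite -Zcyc.
  - by rewrite Zcyc.
  - by rewrite Zanti Zcyc H oppr0.
case: (Zs _ _ _ Z012) (Zs _ _ _ Z013) => ? ? ? ? ? [? ? ? ? ?].
case: (Zs _ _ _ Z023) (Zs _ _ _ Z123) => ? ? ? ? ? [? ? ? ? ?].
have Z0' i j : Z i j i y = 0 by rewrite Zcyc Z0.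
have Z0'' i j : Z i i j y = 0 by rewrite Zcyc Z0'.
by case: (ord4P a) => ->; case: (ord4P k) => ->; case: (ord4P l) => ->.
Qed.

Let kappa l y := \sum_k iota (lambda (e k)) * K' k l y.

(* Exactness of the Koszul complex of [f], contracted by the coordinates
   [lambda (e a)] of 1 in the basis [f]. *)
Let K'kappa k l y : K' k l y = kappa l (f k * y) - kappa k (f l * y).
Proof.
have {1}-> : y = \sum_a (lambda (e a) : R) *: (f a * y).
  rewrite -[LHS]mul1r {1}(expand_right ef 1) mulr_suml.
  by apply: eq_bigr => a _; rewrite mul1r restr_scalerAl.
rewrite (linear_over_comb (K'L _ _)) /kappa -sumrB.
apply: eq_bigr => a _; rewrite -mulrBr; congr (_ * _).
rewrite (K'anti a l) -opprD; apply/eqP; rewrite -addr_eq0 addrA.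
by apply/eqP/K'cocycle.
Qed.

Let kappaL l : linear_over iota (kappa l).
Proof.
move=> r u v; rewrite /kappa mulr_sumr -big_split; apply: eq_bigr => k _ /=.
by rewrite K'L mulrDr !mulrA -!rmorphM [r * _]mulrC.
Qed.

Let kappa_sym l m : kappa l (f m) = kappa m (f l).
Proof.
have := K'kappa m l 1; rewrite !mulr1 /K' Kone => /esym/eqP.
by rewrite subr_eq0 => /eqP.
Qed.

Let co (v : V) i : R := lambda (v * f i).

Let co_mul s v : co (s * v) =1 fun j => \sum_i co v i * mulmat lambda e f s i j.
Proof. by move=> j; apply: mulmat_coord. Qed.

(** Substitutes [K'kappa] into the expansion of K in the basis [e]. *)
Let K_kappa v y w :
  K v y w =
  \sum_k \sum_l iota (wedge_dual (co v) (co w) k l) * kappa l (f k * y).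
Proof.
have -> : K v y w = \sum_i \sum_j iota (co v i * co w j) * K (e i) y (e j).
  rewrite {1}(expand_left ef v) {1}(expand_left ef w).
  rewrite (linear_over_comb (K1 _ _)); apply: eq_bigr => i _.
  rewrite (linear_over_comb (K3 _ _)) mulr_sumr; apply: eq_bigr => j _.
  by rewrite rmorphM mulrA.
rewrite pair_big /= (reindex_inj (inv_inj compl_pairK)) /=.
pose c k l := co v (compl_pair (k, l)).1 * co w (compl_pair (k, l)).2.
transitivity (\sum_k \sum_l
    iota (c k l) * (kappa l (f k * y) - kappa k (f l * y))).
  rewrite pair_big /=; apply: eq_bigr => -[k l] _.
  by rewrite -K'kappa.
transitivity (\sum_k \sum_l iota (c k l) * kappa l (f k * y)
    - \sum_k \sum_l iota (c k l) * kappa k (f l * y)).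
  rewrite -sumrB; apply: eq_bigr => k _; rewrite -sumrB.
  by apply: eq_bigr => l _; rewrite mulrBr.
(* Exchanging k and l in the second sum moves the antisymmetrisation from [kappa] to the
   coefficients, where it produces [wedge_dual]. *)
rewrite [X in _ - X]exchange_big -sumrB; apply: eq_bigr => k _.
rewrite -sumrB; apply: eq_bigr => l _; rewrite -mulrBl -rmorphB /c.
by rewrite (compl_pair_swap k l).
Qed.

(** The factor [s] passes from the argument of [kappa] to the coefficients, through the matrix of
    multiplication by [s] on the [f k]. *)
Let K_mul v s y w : K v (s * y) w = \sum_m \sum_l
  iota (\sum_k mulmat lambda e f s m k * wedge_dual (co v) (co w) k l)
  * kappa l (f m * y).
Proof.
rewrite K_kappa.
transitivity (\sum_k \sum_l \sum_m iota (mulmat lambda e f s m k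
    * wedge_dual (co v) (co w) k l) * kappa l (f m * y)).
  apply: eq_bigr => k _; apply: eq_bigr => l _.
  rewrite mulrA [f k * s]mulrC (mulmat_right ef) mulr_suml.
  under eq_bigr do rewrite restr_scalerAl.
  rewrite (linear_over_comb (kappaL l)) mulr_sumr; apply: eq_bigr => m _.
  by rewrite mulrA -rmorphM [_ * mulmat _ _ _ _ _ _]mulrC.
under eq_bigr do rewrite exchange_big.
rewrite exchange_big; apply: eq_bigr => m _.
rewrite exchange_big; apply: eq_bigr => l _.
by rewrite -mulr_suml -rmorph_sum.
Qed.

(** The pairing of an alternating matrix with the symmetric form [kappa l (f m)]. Writing the matrix
    as a difference of transposes keeps the argument valid in characteristic 2. *)
Let pairing_antisym (P : 'I_4 -> 'I_4 -> R) :
  \sum_m \sum_l iota (P m l - P l m) * kappa l (f m) = 0.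
Proof.
transitivity (\sum_m \sum_l iota (P m l) * kappa l (f m)
    - \sum_m \sum_l iota (P l m) * kappa l (f m)).
  rewrite -sumrB; apply: eq_bigr => m _; rewrite -sumrB.
  by apply: eq_bigr => l _; rewrite rmorphB mulrBl.
apply/eqP; rewrite subr_eq0; apply/eqP; rewrite [RHS]exchange_big.
by apply: eq_bigr => m _; apply: eq_bigr => l _; rewrite kappa_sym.
Qed.

(** Every term is a pairing of [kappa] with a matrix. With M the matrix of [s] and D the
    [wedge_dual] of the coordinates of [t] and 1, [wedge_dual_trace] reduces the total matrix to - M
    D M^T. This is alternating because D is. *)
Lemma quartic_identity (s t : V) :
  K (t * s) s 1 + K t s s + K t (s * s) 1
  - iota (\sum_i mulmat lambda e f s i i) * K t s 1 = 0.
Proof.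
set M := mulmat lambda e f s; set tr := \sum_i M i i.
pose D := wedge_dual (co t) (co 1).
pose act (u : 'I_4 -> R) j := \sum_i u i * M i j.
have Ks v w : K v s w = \sum_m \sum_l
    iota (\sum_k M m k * wedge_dual (co v) (co w) k l) * kappa l (f m).
  rewrite -[s in LHS]mulr1 K_mul; apply: eq_bigr => m _.
  by apply: eq_bigr => l _; rewrite mulr1.
have Kss : K t (s * s) 1 = \sum_m \sum_l
    iota (\sum_k M m k * \sum_j M k j * D j l) * kappa l (f m).
  rewrite -[s * s]mulr1 K_mul; apply: eq_bigr => m _.
  apply: eq_bigr => l _; rewrite mulr1; congr (iota _ * _).
  (* The matrix of [s * s] is the square of M. *)
  under eq_bigr => j _.
    rewrite {1}/mulmat -[s * s * _]mulrA (mulmat_coord ef) mulr_suml; over.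
  rewrite exchange_big; apply: eq_bigr => k _ /=; rewrite mulr_sumr.
  by apply: eq_bigr => j _; rewrite mulrA.
have D1 k l : wedge_dual (co (t * s)) (co 1) k l
    = wedge_dual (act (co t)) (co 1) k l.
  by rewrite /wedge_dual [t * s]mulrC !co_mul.
have D2 k l : wedge_dual (co t) (co s) k l
    = wedge_dual (co t) (act (co 1)) k l.
  by rewrite /wedge_dual -[s]mulr1 !co_mul.
(* Chosen so that M D M^T has entries [Q m l - Q l m]. *)
pose Q m l := \sum_k \sum_j M m k * M l j
  * (co t (compl_pair (k, j)).1 * co 1 (compl_pair (k, j)).2).
rewrite -[RHS](pairing_antisym (fun m l => Q l m)) !Ks Kss mulr_sumr.
rewrite -!big_split -sumrB; apply: eq_bigr => m _ /=.
rewrite mulr_sumr -!big_split -sumrB; apply: eq_bigr => l _ /=.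
rewrite mulrA -rmorphM -!mulrDl -!rmorphD -mulrBl -rmorphB.
congr (iota _ * _); rewrite mulr_sumr -!big_split -sumrB /=.
have QD : Q l m - Q m l = \sum_k M m k * - \sum_j M l j * D k j.
  rewrite /Q [X in X - _]exchange_big -sumrB; apply: eq_bigr => k _ /=.
  rewrite -sumrB mulrN mulr_sumr -sumrN; apply: eq_bigr => j _.
  by rewrite /D /wedge_dual (compl_pair_swap k j) /=; ring.
rewrite QD; apply: eq_bigr => k _; rewrite D1 D2.
have := wedge_dual_trace M (co t) (co 1) k l; rewrite /= -/tr -/D => H.
rewrite mulrCA -H /act; ring.
Qed.

End Quartic.

Lemma subrACA (V : zmodType) (a b c d : V) :
  a - b - (c - d) = a - c - (b - d).
Proof. by rewrite !opprD addrACA. Qed.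

(** * Noetherian modules over central subrings and Hilbert's basis theorem *)

Section CentralSubrings.
Context (A : pzRingType).
Implicit Types (B L N : A -> Prop) (l : seq A).

(** Subrings and modules are predicates on the ambient ring, so that adjoining elements stays inside
    [A] and creates no new ring type. *)
Definition central_subring B : Prop :=
  [/\ B 1, forall x y, B x -> B y -> B (x - y),
      forall x y, B x -> B y -> B (x * y) & forall x, B x -> in_center x].

Definition submodule B L : Prop :=
  [/\ L 0, forall x y, L x -> L y -> L (x - y) &
      forall b x, B b -> L x -> L (b * x)].

(** Coefficients are split off one at a time, from the head of the list; the head thus serves as a
    leading term in the inductions below. *)
Fixpoint span B l : A -> Prop :=
  if l is g :: l' then fun x => exists2 b, B b & span B l' (x - b * g)
  else fun x => x = 0.

Definition noeth B N : Prop :=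
  forall L, submodule B L -> (forall x, L x -> N x) ->
  exists l, forall x, L x <-> span B l x.

Lemma submodule_opp B L x : submodule B L -> L x -> L (- x).
Proof. by case=> L0 LB _ Lx; rewrite -sub0r; apply: LB. Qed.

Lemma submodule_add B L x y : submodule B L -> L x -> L y -> L (x + y).
Proof.
by move=> LM Lx Ly; rewrite -[y]opprK; case: (LM) => _ + _; apply=> //;
  apply: submodule_opp LM _.
Qed.

Lemma submodule_sum B L (I : finType) (u : I -> A) :
  submodule B L -> (forall i, L (u i)) -> L (\sum_i u i).
Proof.
move=> LM Lu; apply: (big_ind L) => //; first by case: LM.
by move=> x y; apply: submodule_add LM.
Qed.

Lemma submodule_subring B : central_subring B -> submodule B B.
Proof. by case=> B1 BB BM _; split=> //; rewrite -(subrr 1); apply: BB. Qed.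

Lemma span_submodule B l : central_subring B -> submodule B (span B l).
Proof.
move=> Bring; have [B0 BB BM] := submodule_subring Bring.
elim: l => [|g l [IH0 IHB IHM]] /=.
  by split=> // [x y -> ->|b x _ ->]; rewrite ?subrr ?mulr0.
split; first by exists 0; rewrite ?mul0r ?subr0.
- move=> x y [b Bb Hx] [c Bc Hy]; exists (b - c); first exact: BB.
  by rewrite mulrBl subrACA; apply: IHB.
- move=> b x Bb [c Bc Hx]; exists (b * c); first exact: BM.
  by rewrite -mulrA -mulrBr; apply: IHM.
Qed.

Lemma span_mem B l g : central_subring B -> g \in l -> span B l g.
Proof.
move=> Bring; have [B0 _ _] := submodule_subring Bring.
elim: l => //= h l IH; rewrite inE => /orP[/eqP ->|/IH Hg].
  exists 1; first by case: Bring.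
  by rewrite mul1r subrr; case: (span_submodule l Bring).
by exists 0; rewrite ?mul0r ?subr0.
Qed.

Lemma span_min B L l x :
  submodule B L -> (forall g, g \in l -> L g) -> span B l x -> L x.
Proof.
move=> LM; elim: l x => [|g l IH] x Ll /=; first by move=> ->; case: LM.
case=> b Bb Hx; rewrite -(subrK (b * g) x); apply: (submodule_add LM).
  by apply: IH => // h hl; apply: Ll; rewrite inE hl orbT.
by case: LM => _ _; apply=> //; apply: Ll; rewrite inE eqxx.
Qed.

Lemma span_sub B B' l l' x : central_subring B' -> (forall b, B b -> B' b) ->
  {subset l <= l'} -> span B l x -> span B' l' x.
Proof.
move=> B'ring sub ll'; apply: span_min => [|g /ll']; last exact: span_mem.
have [S0 SB SM] := span_submodule l' B'ring.
by split=> // b y /sub; apply: SM.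
Qed.

Lemma span_catl B l l' x :
  central_subring B -> span B l x -> span B (l ++ l') x.
Proof.
by move=> Bring; apply: span_sub => // i il; rewrite mem_cat il.
Qed.

(** As [B] is central, the map sending m to y m z is B-linear, so the generators suffice. *)
Lemma span_sandwich B l l' y z m : central_subring B ->
  {subset [seq y * g * z | g <- l] <= l'} ->
  span B l m -> span B l' (y * m * z).
Proof.
move=> Bring ll'; have [_ _ _ BC] := Bring.
apply: (span_min (L := fun m => span B l' (y * m * z))).
  have [S0 SB SZ] := span_submodule l' Bring.
  split=> [|g h Hg Hh|d g Bd Hg].
  - by rewrite mulr0 mul0r.
  - by rewrite mulrBr mulrBl; apply: SB.
  - by rewrite mulrA -(BC _ Bd) -!mulrA; apply: SZ; rewrite // mulrA.
by move=> g gl; apply: span_mem => //; apply/ll'/map_f.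
Qed.

Lemma span_sum B l x : span B l x -> exists2 c : 'I_(size l) -> A,
  forall i, B (c i) & x = \sum_i c i * tnth (in_tuple l) i.
Proof.
elim: l x => [|g l IH] x /=.
  by move=> ->; exists (fun=> 0) => [[]|]; rewrite ?big_ord0.
case=> b Bb /IH[c Bc xE].
exists (fun i => if unlift ord0 i is Some j then c j else b) => [i|].
  by case: unliftP => [j|] _.
rewrite big_ord_recl unlift_none -(subrK (b * g) x) addrC xE.
congr (_ + _); apply: eq_bigr => i _; rewrite liftK; congr (_ * _).
by rewrite !(tnth_nth 0).
Qed.

(** Chooses elements of [L] whose coefficients at [g], modulo [span B l], are the given [js]; their
    combinations then realise all of [span B js]. *)
Lemma noeth_lift B L g l js :
  central_subring B -> submodule B L ->
  (forall j, j \in js -> exists2 h, L h & span B l (h - j * g)) ->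
  exists2 hs, forall h, h \in hs -> L h &
    forall b, span B js b -> exists2 h, span B hs h & span B l (h - b * g).
Proof.
move=> Bring LM; have [S0 SB SM] := span_submodule l Bring.
elim: js => [|j js IH] Hjs.
  exists [::] => // b /= ->; exists 0 => //; by rewrite mul0r subrr.
have [i ijs|hs Lhs Hhs] := IH; first by apply: Hjs; rewrite inE ijs orbT.
have [h Lh Hh] := Hjs j (mem_head _ _).
exists (h :: hs) => [i|b /= [c Bc /Hhs[h' Hh' Hb]]].
  by rewrite inE => /orP[/eqP ->|/Lhs].
exists (c * h + h'); first by exists c => //; rewrite addrAC subrr add0r.
rewrite -[b](subrK (c * j)) mulrDl [c * h + _]addrC opprD addrACA.
rewrite -mulrA -mulrBr; apply: (submodule_add (span_submodule l Bring)) => //.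
exact: SM.
Qed.

(** Induction on the generators: [L] is generated by lifts of its coefficients at [g] together with
    generators of its intersection with [span B l]. *)
Lemma noeth_span B l : central_subring B -> noeth B B -> noeth B (span B l).
Proof.
move=> Bring Bn; have [B0 BB BM] := submodule_subring Bring.
elim: l => [|g l IH] L LM LS.
  by exists [::] => x; split=> [/LS|->] //; case: LM.
have SM := span_submodule l Bring.
have [L0 LB LZ] := LM; have [S0 SB SZ] := SM.
(* The ideal of possible coefficients at [g] of elements of [L]. *)
pose J b := B b /\ exists2 h, L h & span B l (h - b * g).
have JM : submodule B J.
  split; first by split=> //; exists 0; rewrite ?mul0r ?subr0.
    move=> b c [Bb [h Lh Hh]] [Bc [k Lk Hk]]; split; first exact: BB.
    exists (h - k); first exact: LB.
    by rewrite mulrBl subrACA; apply: SB.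
  move=> b c Bb [Bc [h Lh Hh]]; split; first exact: BM.
  by exists (b * h); [apply: LZ|rewrite -mulrA -mulrBr; apply: SZ].
have [js Hjs] := Bn J JM (fun b => @proj1 _ _).
have [j /(span_mem Bring)/Hjs[]//|hs Lhs Hhs] :=
  @noeth_lift B L g l js Bring LM.
pose L' x := L x /\ span B l x.
have L'M : submodule B L'.
  split=> [//|x y [Lx Sx] [Ly Sy]|b x Bb [Lx Sx]].
    by split; [apply: LB|apply: SB].
  by split; [apply: LZ|apply: SZ].
have [ls Hls] := IH L' L'M (fun x => @proj2 _ _).
exists (hs ++ ls) => x; split=> [Lx|]; last first.
  apply: span_min => // h; rewrite mem_cat => /orP[/Lhs//|].
  by move/(span_mem Bring)/Hls => -[].
have [b Bb Hx] := LS _ Lx.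
have [h Sh Hh] : exists2 h, span B hs h & span B l (h - b * g).
  by apply/Hhs/Hjs; split=> //; exists x.
rewrite -(subrK h x); apply: (submodule_add (span_submodule _ Bring)).
  apply: (@span_sub B B ls) => // [i il|]; first by rewrite mem_cat il orbT.
  apply/Hls; split; first by apply: LB => //; apply: span_min Sh.
  by rewrite -[x - h](subrKA (b * g)) -[b * g - h]opprB; apply: SB.
by apply: (@span_sub B B hs) => // i il; rewrite mem_cat il.
Qed.

Section Adjoin.
Context (B : A -> Prop) (Bring : central_subring B) (z : A).
Hypothesis zC : in_center z.

(** Highest power first, so that [span] splits off the leading term of a polynomial in [z] of degree
    less than n. *)
Fixpoint powers_below n : seq A :=
  if n is n'.+1 then z ^+ n' :: powers_below n' else [::].

Definition adjoin (x : A) : Prop := exists n, span B (powers_below n) x.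

Let F n := span B (powers_below n).
Let FM n : submodule B (F n) := span_submodule (powers_below n) Bring.

Let F_mono n m x : (n <= m)%N -> F n x -> F m x.
Proof.
move=> /subnKC <-; elim: (m - n)%N => [|k IH]; first by rewrite addn0.
move=> /IH Hx; rewrite addnS; exists 0; last by rewrite mul0r subr0.
by case: (submodule_subring Bring).
Qed.

Let F_exp n k x : F n x -> F (n + k) (z ^+ k * x).
Proof.
elim: n x => [|n IH] x.
  by move=> /= ->; rewrite mulr0; case: (FM (0 + k)).
case=> b Bb /IH Hx; exists b => //=.
suff -> : z ^+ k * x - b * z ^+ (n + k) = z ^+ k * (x - b * z ^+ n) by [].
have bC : in_center b by case: Bring => _ _ _; apply.
by rewrite mulrBr mulrA -(bC (z ^+ k)) -mulrA -exprD addnC.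
Qed.

Let adjoinM : submodule B adjoin.
Proof.
split=> [|x y [n Hx] [m Hy]|b x Bb [n Hx]]; first by exists 0%N.
  exists (maxn n m); case: (FM (maxn n m)) => _ + _; apply.
    exact: F_mono (leq_maxl n m) Hx.
  exact: F_mono (leq_maxr n m) Hy.
by exists n; case: (FM n) => _ _; apply.
Qed.

Let F_exponent n : F n.+1 (z ^+ n).
Proof.
exists 1; first by case: Bring.
by rewrite mul1r subrr; case: (FM n).
Qed.

Lemma adjoin_base b : B b -> adjoin b.
Proof.
move=> Bb; exists 1%N; exists b => //=.
by rewrite expr0 mulr1 subrr.
Qed.

Lemma adjoin_elt : adjoin z.
Proof. by exists 2%N; rewrite -[z]expr1; apply: (F_exponent 1). Qed.

Lemma adjoin_subring : central_subring adjoin.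
Proof.
have [a0 aB aZ] := adjoinM; split=> //.
- by apply: adjoin_base; case: Bring.
- move=> x y [n Hx] Hy; elim: n x Hx => [|n IH] x.
    by move=> /= ->; rewrite mul0r.
  case=> b Bb /IH Hx; rewrite -(subrK (b * z ^+ n) x) mulrDl.
  apply: (submodule_add adjoinM) => //.
  rewrite -mulrA; apply: aZ => //; case: Hy => m Hy.
  by exists (m + n)%N; apply: F_exp.
- move=> x [n]; elim: n x => [|n IH] x.
    by move=> /= -> y; rewrite mul0r mulr0.
  case=> b Bb /IH Hx y; rewrite -(subrK (b * z ^+ n) x) mulrDl mulrDr Hx.
  have bC : in_center b by case: Bring => _ _ _; apply.
  congr (_ + _); rewrite -mulrA [RHS]mulrA -(bC y) -mulrA; congr (_ * _).
  exact: esym (commrX n (esym (zC y))).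
Qed.

Hypothesis Bn : noeth B B.

(* Hilbert's basis theorem; elements need not have unique expressions as
   polynomials in [z], so leading coefficients are taken of all of them. *)
Lemma noeth_adjoin : noeth adjoin adjoin.
Proof.
move=> L LM' La.
have LM : submodule B L.
  by case: LM' => L0 LB LZ; split=> // b x /adjoin_base; apply: LZ.
have [L0 LB LZ] := LM; have [B0 BB BM] := submodule_subring Bring.
(* Coefficients of z^n in elements of [L] written with degree at most n; multiplication by z makes
   these ideals increase with n. *)
pose lead n b := B b /\ exists2 h, L h & F n (h - b * z ^+ n).
have leadM n : submodule B (lead n).
  have [S0 SB SZ] := FM n.
  split; first by split=> //; exists 0; rewrite ?mul0r ?subr0.
    move=> b c [Bb [h Lh Hh]] [Bc [k Lk Hk]]; split; first exact: BB.
    exists (h - k); first exact: LB.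
    by rewrite mulrBl subrACA; apply: SB.
  move=> b c Bb [Bc [h Lh Hh]]; split; first exact: BM.
  by exists (b * h); [apply: LZ|rewrite -mulrA -mulrBr; apply: SZ].
have Lexp k x : L x -> L (z ^+ k * x).
  case: LM' => _ _; apply; exists k.+1; exact: F_exponent.
have shift n k b h : B b -> F n (h - b * z ^+ n) ->
    F (n + k) (z ^+ k * h - b * z ^+ (n + k)).
  move=> Bb /(@F_exp _ k); have bC : in_center b by case: Bring => _ _ _; apply.
  by rewrite mulrBr mulrA -(bC (z ^+ k)) -mulrA -exprD [(k + n)%N]addnC.
have lead_mono n m b : (n <= m)%N -> lead n b -> lead m b.
  move=> /subnKC <- [Bb [h Lh Hh]]; split=> //.
  by exists (z ^+ (m - n) * h); [apply: Lexp|apply: shift].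
pose lead_oo b := exists n, lead n b.
have lead_ooM : submodule B lead_oo.
  split; first by exists 0%N; case: (leadM 0%N).
    move=> b c [n Hb] [m Hc]; exists (maxn n m); case: (leadM (maxn n m)) => _.
    move=> + _; apply; first exact: lead_mono (leq_maxl n m) Hb.
    exact: lead_mono (leq_maxr n m) Hc.
  by move=> b c Bb [n Hc]; exists n; case: (leadM n) => _ _; apply.
have [js Hjs] := Bn lead_ooM (fun b '(ex_intro n (conj Bb _)) => Bb).
(* The union of the leading ideals is finitely generated, so the chain is stationary from some d
   on. *)
have [d Hd] : exists d, forall j, j \in js -> lead d j.
  have: forall j, j \in js -> lead_oo j by move=> j /(span_mem Bring)/Hjs.
  elim: js {Hjs} => [|j js IH] Hjs; first by exists 0%N.
  have [i ijs|n Hn] := IH; first by apply: Hjs; rewrite inE ijs orbT.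
  have [m Hm] := Hjs j (mem_head _ _); exists (maxn n m) => i.
  rewrite inE => /orP[/eqP ->|/Hn Hi].
    exact: lead_mono (leq_maxr n m) Hm.
  exact: lead_mono (leq_maxl n m) Hi.
have lead_d b : lead_oo b -> lead d b.
  by move/Hjs; apply: span_min.
(* Lifts of generators of the finitely many leading ideals in degrees 0 to d; they generate [L]. *)
have [gs Lgs Hgs] : exists2 gs, forall g, g \in gs -> L g &
    forall n b, (n < d.+1)%N -> lead n b ->
    exists2 h, span B gs h & F n (h - b * z ^+ n).
  elim: d.+1 => [|k [gs Lgs Hgs]]; first by exists [::].
  have [ks Hks] := Bn (leadM k) (fun b => @proj1 _ _).
  have [j /(span_mem Bring)/Hks[]//|hs Lhs Hhs] :=
    @noeth_lift B L (z ^+ k) (powers_below k) ks Bring LM.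
  exists (hs ++ gs) => [g|n b].
    by rewrite mem_cat => /orP[/Lhs|/Lgs].
  rewrite ltnS leq_eqVlt => /orP[/eqP ->|nk].
    move=> /Hks/Hhs[h Sh Hh]; exists h => //.
    by apply: span_sub Sh => // i il; rewrite mem_cat il.
  move=> /(Hgs _ _ nk)[h Sh Hh]; exists h => //.
  by apply: span_sub Sh => // i il; rewrite mem_cat il orbT.
exists gs => x; split; last by apply: span_min.
have aring := adjoin_subring; have SM := span_submodule gs aring.
move=> Lx; have [n Hx] := La _ Lx; elim: n x Lx Hx => [|n IH] x Lx.
  by move=> /= ->; case: SM.
case=> b Bb Hx.
(* Subtracting a combination of [gs] with the same leading term lowers the degree bound of [x]. *)
suff [h Sh Hh] : exists2 h, span adjoin gs h & F n (h - b * z ^+ n).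
  rewrite -(subrK h x); apply: (submodule_add SM) => //; apply: IH.
    by apply: LB => //; apply: span_min Sh.
  rewrite -[x - h](subrKA (b * z ^+ n)) -[b * _ - h]opprB.
  by case: (FM n) => _ + _; apply.
have lead_b : lead n b by split=> //; exists x.
have spanW h : span B gs h -> span adjoin gs h.
  by apply: span_sub => //; apply: adjoin_base.
have [nd|dn] := ltnP n d.+1.
  by have [h /spanW Sh Hh] := Hgs n b nd lead_b; exists h.
(* Above degree d the leading coefficient already occurs in degree d, and the lift is multiplied by
   z^(n-d). *)
have [h /spanW Sh Hh] := Hgs d b (ltnSn d) (lead_d b (ex_intro _ n lead_b)).
exists (z ^+ (n - d) * h).
  by case: SM => _ _; apply=> //; exists (n - d).+1; apply: F_exponent.
by have := shift d (n - d)%N b h Bb Hh; rewrite subnKC // ltnW.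
Qed.

End Adjoin.

Lemma noeth_adjoin_seq B (zs : seq A) : central_subring B -> noeth B B ->
  (forall z, z \in zs -> in_center z) ->
  exists B', [/\ central_subring B', noeth B' B', forall b, B b -> B' b &
    forall z, z \in zs -> B' z].
Proof.
move=> Bring Bn; elim: zs => [|z zs IH] zsC; first by exists B.
have [i izs|B' [B'ring B'n BB' B'zs]] := IH.
  by apply: zsC; rewrite inE izs orbT.
have zC : in_center z by apply: zsC; rewrite inE eqxx.
exists (adjoin B' z); split.
- exact: adjoin_subring.
- exact: noeth_adjoin.
- by move=> b /BB'; apply: adjoin_base.
- move=> i; rewrite inE => /orP[/eqP ->|/B'zs]; first exact: adjoin_elt.
  exact: adjoin_base.
Qed.

(** [A] is a noetherian B-module, and by centrality left and right ideals alike are B-submodules. *)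
Lemma finite_over_noeth B l : central_subring B -> noeth B B ->
  (forall x, span B l x) -> noetherian A /\ finite_over_center A.
Proof.
move=> Bring Bn Al.
have BC b : B b -> in_center b by case: Bring => _ _ _; apply.
have An : noeth B (fun=> True).
  by move=> L LM _; apply: (@noeth_span B l).
split; last first.
  exists (size l), (fun i => tnth (in_tuple l) i) => x.
  have [c Bc ->] := span_sum (Al x).
  by exists c; split=> // i; apply: BC.
split=> I [I0 IB IM].
  have [|gs Hgs] := An I _ (fun _ _ => Logic.I).
    by split=> // b x _; apply: IM.
  exists (size gs), (fun i => tnth (in_tuple gs) i) => x; split.
    by move=> /Hgs/span_sum[c _ ->]; exists c.
  case=> c ->; apply: (@submodule_sum (fun=> True)) => [|i].
    by split=> // b y _; apply: IM.
  by apply/IM/Hgs/span_mem => //; apply: mem_tnth.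
have [|gs Hgs] := An I _ (fun _ _ => Logic.I).
  by split=> // b x /BC bC; rewrite bC; apply: IM.
exists (size gs), (fun i => tnth (in_tuple gs) i : A^c) => x; split.
  move=> /Hgs/span_sum[c Bc ->]; exists c.
  by apply: eq_bigr => i _; rewrite (BC _ (Bc i)).
case=> c ->; apply: (@submodule_sum (fun b => in_center b)) => [|i].
  by split=> // b y bC; rewrite bC; apply: IM.
by apply/IM/Hgs/span_mem => //; apply: mem_tnth.
Qed.

End CentralSubrings.

(** Submodules of the image pull back to left ideals of [R]. *)
Lemma noeth_image (R A : pzRingType) (iota : {rmorphism R -> A}) :
  left_noetherian R -> (forall r, in_center (iota r)) ->
  let B x := exists r, x = iota r in central_subring B /\ noeth B B.
Proof.
move=> Rn iotaC B.
have Bring : central_subring B.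
  split; first by exists 1; rewrite rmorph1.
  - by move=> _ _ [r ->] [r' ->]; exists (r - r'); rewrite rmorphB.
  - by move=> _ _ [r ->] [r' ->]; exists (r * r'); rewrite rmorphM.
  - by move=> _ [r ->].
split=> // L [L0 LB LM] LR.
have [|m [g Hg]] := Rn (fun r => L (iota r)).
  split=> [|x y|r x]; rewrite ?rmorph0 ?rmorphB ?rmorphM //; first exact: LB.
  by apply: LM; exists r.
exists [seq iota (g i) | i <- enum 'I_m] => x; split.
  move=> Lx; have [r xE] := LR _ Lx; move: Lx; rewrite xE => /Hg[c ->].
  rewrite rmorph_sum; apply: submodule_sum (span_submodule _ Bring) _ => i.
  rewrite rmorphM.
  case: (span_submodule [seq iota (g i) | i <- enum 'I_m] Bring).
  move=> _ _; apply; first by exists (c i).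
  by apply: span_mem => //; apply: map_f; rewrite mem_enum.
apply: span_min => // _ /mapP[i _ ->]; apply/Hg; exists (fun j => (j == i)%:R).
rewrite (bigD1 i) //= eqxx mul1r big1 ?addr0 // => j ji.
by rewrite (negbTE ji) mul0r.
Qed.

(** * The tensor algebra is generated in degrees 0 and 1 *)

Section TensorAlgebraGenerators.
Context (A : pzRingType) (B : bimodType A).
Local Notation T := (tensor_alg B).

Lemma tgen0_zmod_morphism : zmod_morphism (@tgen0 A B).
Proof. by move=> a a'; rewrite /tgen0 raddfB. Qed.

Lemma tgen0_monoid_morphism : monoid_morphism (@tgen0 A B).
Proof. by split=> // a a'; rewrite [RHS]ta_mul_hom. Qed.

HB.instance Definition _ :=
  GRing.isZmodMorphism.Build A T (@tgen0 A B) tgen0_zmod_morphism.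
HB.instance Definition _ :=
  GRing.isMonoidMorphism.Build A T (@tgen0 A B) tgen0_monoid_morphism.

Lemma tgen1D (b b' : B) : tgen1 (b + b') = tgen1 b + tgen1 b' :> T.
Proof. by rewrite /tgen1 tensDl raddfD. Qed.

Lemma tgen0_tgen1 a (b : B) : tgen0 B a * tgen1 b = tgen1 (a *: b).
Proof. by rewrite [LHS]ta_mul_hom /= tensZ. Qed.

Lemma tgen1_tgen0 a (b : B) : tgen1 b * tgen0 B a = tgen1 (ract b a).
Proof.
rewrite [LHS]ta_mul_hom tmul_tens /tgen1; congr (thom _).
by rewrite tensA /= scale1r; congr (tens _ _); rewrite /GRing.scale /= mulr1.
Qed.

Lemma tensor_alg_left_ind (P : T -> Prop) :
  P 0 -> (forall x y, P x -> P y -> P (x - y)) ->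
  (forall a, P (tgen0 B a)) -> (forall b x, P x -> P (tgen1 b * x)) ->
  forall x, P x.
Proof.
move=> P0 PB Pgen0 Pgen1; apply: tensor_alg_ind => // [x y Px Py|].
  by rewrite -[y]opprK; apply: (PB) => //; rewrite -sub0r; apply: PB.
elim=> [|n IH] v; first exact: Pgen0.
elim/tensor_ind: v => [|u v Pu Pv|b v]; first by rewrite raddf0.
  by rewrite raddfB; apply: PB.
suff -> : thom (tens b v : tpow B n.+1) = tgen1 b * thom v by apply: Pgen1.
by rewrite [RHS]ta_mul_hom tmul_tens /= scale1r.
Qed.

End TensorAlgebraGenerators.

(** * Generators and relations of the preprojective algebra *)

Section Preproj.
Context (R S : comPzRingType) (phi : {rmorphism R -> S}).
Context (n : nat) (e f : 'I_n -> restr phi).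
Local Notation P := (preproj phi e f).
Local Notation V := (restr phi).
Local Notation B := (bimodM phi * bimodN phi)%type.

Definition pr : TRS phi -> P := @qproj (TRS phi) (preproj_relator e f).
HB.instance Definition _ := GRing.RMorphism.on pr.

Definition scal (r : R) : P := pr (tgen0 B (r, phi r)).

Fact scal_zmod_morphism : zmod_morphism scal.
Proof. by move=> r r'; rewrite /scal -!rmorphB /= rmorphB. Qed.

Fact scal_monoid_morphism : monoid_morphism scal.
Proof.
split=> [|r r']; rewrite /scal; last by rewrite -!rmorphM /= rmorphM.
by rewrite rmorph1 -[(1, 1)]/(1 : R * S) !rmorph1.
Qed.

HB.instance Definition _ :=
  GRing.isZmodMorphism.Build R P scal scal_zmod_morphism.
HB.instance Definition _ :=
  GRing.isMonoidMorphism.Build R P scal scal_monoid_morphism.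

(** Quiver notation: [vR] and [atS 1] are the idempotents of the two vertices, [arrM] is the arrow
    a, [arrN] the arrow b, and [loopS] the loop x = b a. *)
Definition vR : P := pr (tgen0 B (1, 0)).
Definition atS (s : V) : P := pr (tgen0 B (0, s)).
Definition arrM : P := pr (genM phi 1).
Definition arrN : P := pr (genN phi 1).
Definition loopS : P := arrN * arrM.

Lemma atSM s t : atS (s * t) = atS s * atS t.
Proof.
by rewrite /atS -!rmorphM; congr (pr (tgen0 _ (_, _))); rewrite /= mulr0.
Qed.

Lemma vR_atS : vR + atS 1 = 1.
Proof.
rewrite /vR /atS -!rmorphD -[RHS](rmorph1 pr) -[in RHS](rmorph1 (tgen0 B)).
by congr (pr (tgen0 _ (_, _))); rewrite /= ?addr0 ?add0r.
Qed.

Lemma vR_idem : vR * vR = vR.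
Proof.
rewrite /vR -!rmorphM; congr (pr (tgen0 _ (_, _))).
  by rewrite /= mulr1.
by rewrite /= mulr0.
Qed.

Lemma vR_mul_atS s : vR * atS s = 0.
Proof.
rewrite /vR /atS -!rmorphM -[RHS](rmorph0 pr) -[in RHS](rmorph0 (tgen0 B)).
by congr (pr (tgen0 _ (_, _))); rewrite /= ?mulr0 ?mul0r.
Qed.

Lemma atS_mul_vR s : atS s * vR = 0.
Proof.
rewrite /vR /atS -!rmorphM -[RHS](rmorph0 pr) -[in RHS](rmorph0 (tgen0 B)).
by congr (pr (tgen0 _ (_, _))); rewrite /= ?mulr0 ?mul0r.
Qed.

Lemma scal_mul_atS r s : scal r * atS s = atS (r *: s).
Proof.
rewrite /scal /atS -!rmorphM; congr (pr (tgen0 _ (_, _))).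
by rewrite /= mulr0.
Qed.

Lemma tgen0_decomp (c : R * S) : pr (tgen0 B c) = scal c.1 * vR + atS c.2.
Proof.
case: c => r s; rewrite /scal /vR /atS -!rmorphM -!rmorphD.
by congr (pr (tgen0 _ (_, _))); rewrite /= ?mulr1 ?mulr0 ?addr0 ?add0r.
Qed.

Lemma tgen1_0 : tgen1 (0 : B) = 0 :> TRS phi.
Proof. by apply: (addIr (tgen1 (0 : B))); rewrite -tgen1D !add0r. Qed.

Lemma lactE (c : R * S) m m' : c *: ((m, m') : B) = (phi c.1 * m, c.2 * m').
Proof. by []. Qed.

Lemma ractE (c : R * S) m m' : ract ((m, m') : B) c = (m * c.2, m' * phi c.1).
Proof. by []. Qed.

Lemma genM_decomp s : pr (genM phi s) = arrM * atS s.
Proof.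
rewrite /atS /arrM -rmorphM; congr (pr _); rewrite [RHS]tgen1_tgen0 ractE /=.
by rewrite mul1r rmorph0 mulr0.
Qed.

Lemma genN_decomp s : pr (genN phi s) = atS s * arrN.
Proof.
rewrite /atS /arrN -rmorphM; congr (pr _); rewrite [RHS]tgen0_tgen1 lactE /=.
by rewrite mulr1 mulr0.
Qed.

Lemma tgen1_decomp (m m' : S) :
  pr (tgen1 ((m, m') : B)) = arrM * atS m + atS m' * arrN.
Proof.
rewrite -genM_decomp -genN_decomp -rmorphD -tgen1D; congr (pr (tgen1 (_, _))).
  by rewrite /= addr0.
by rewrite /= add0r.
Qed.

Lemma vR_arrM : vR * arrM = arrM.
Proof.
rewrite /vR /arrM -rmorphM; congr (pr _); rewrite [LHS]tgen0_tgen1 lactE /=.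
by rewrite rmorph1 mul1r mulr0.
Qed.

Lemma arrM_vR : arrM * vR = 0.
Proof.
rewrite /vR /arrM -rmorphM -[RHS](rmorph0 pr); congr (pr _).
by rewrite [LHS]tgen1_tgen0 ractE /= mulr0 mul0r -[RHS]tgen1_0.
Qed.

Lemma atS_arrM s : atS s * arrM = 0.
Proof.
rewrite /atS /arrM -rmorphM -[RHS](rmorph0 pr); congr (pr _).
by rewrite [LHS]tgen0_tgen1 lactE /= rmorph0 mul0r mulr0 -[RHS]tgen1_0.
Qed.

Lemma arrN_vR : arrN * vR = arrN.
Proof.
rewrite /vR /arrN -rmorphM; congr (pr _); rewrite [LHS]tgen1_tgen0 ractE /=.
by rewrite rmorph1 mulr1 mulr0.
Qed.

Lemma vR_arrN : vR * arrN = 0.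
Proof.
rewrite /vR /arrN -rmorphM -[RHS](rmorph0 pr); congr (pr _).
by rewrite [LHS]tgen0_tgen1 lactE /= mulr0 mul0r -[RHS]tgen1_0.
Qed.

Lemma arrN_atS s : arrN * atS s = 0.
Proof.
rewrite /atS /arrN -rmorphM -[RHS](rmorph0 pr); congr (pr _).
by rewrite [LHS]tgen1_tgen0 ractE /= rmorph0 mul0r mulr0 -[RHS]tgen1_0.
Qed.

Lemma arrM_arrN : arrM * arrN = 0.
Proof.
rewrite /arrM /arrN -rmorphM -[RHS](rmorph0 pr); apply/qprojP; rewrite subr0.
exact/ideal_gen_sub/preproj_relR.
Qed.

Lemma casimir_loop : \sum_i atS (e i) * loopS * atS (f i) = 0.
Proof.
transitivity (pr (\sum_i genN phi (e i) * genM phi (f i))).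
  rewrite rmorph_sum; apply: eq_bigr => i _.
  by rewrite rmorphM /= genM_decomp genN_decomp /loopS !mulrA.
rewrite -[RHS](rmorph0 pr); apply/qprojP; rewrite subr0.
exact/ideal_gen_sub/preproj_relS.
Qed.

(** Every element is obtained from degree 0 by differences and left multiplication by arrows, each
    carrying its scalar from S. *)
Lemma preproj_left_ind (Q : P -> Prop) :
  Q 0 -> (forall x y, Q x -> Q y -> Q (x - y)) ->
  (forall r, Q (scal r * vR)) -> (forall s, Q (atS s)) ->
  (forall s x, Q x -> Q (arrM * atS s * x)) ->
  (forall s x, Q x -> Q (atS s * arrN * x)) ->
  forall x, Q x.
Proof.
move=> Q0 QB QR QS QM QN x; have [y ->] := qproj_repr x; rewrite -/(pr y).
have QD u v : Q u -> Q v -> Q (u + v).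
  move=> Qu Qv; rewrite -[v]opprK; apply: (QB) => //.
  by rewrite -sub0r; apply: QB.
elim/tensor_alg_left_ind: y => [|u v Qu Qv|c|[m m'] u Qu].
- by rewrite rmorph0.
- by rewrite rmorphB; apply: QB.
- by rewrite tgen0_decomp; apply: QD.
by rewrite rmorphM /= tgen1_decomp mulrDl; apply: QD; [apply: QM|apply: QN].
Qed.

Lemma scal_central r : in_center (scal r).
Proof.
have comS s : scal r * atS s = atS s * scal r.
  rewrite /scal /atS -!rmorphM; congr (pr (tgen0 _ (_, _))).
    by rewrite /= mulr0 mul0r.
  exact: mulrC.
have comR : scal r * vR = vR * scal r.
  rewrite /scal /vR -!rmorphM; congr (pr (tgen0 _ (_, _))); first exact: mulrC.
  by rewrite /= mulr0 mul0r.
have comM : scal r * arrM = arrM * scal r.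
  rewrite /scal /arrM -!rmorphM; congr (pr _).
  rewrite [LHS]tgen0_tgen1 [RHS]tgen1_tgen0.
  by rewrite lactE ractE /= mulr0 mul0r mulrC.
have comN : scal r * arrN = arrN * scal r.
  rewrite /scal /arrN -!rmorphM; congr (pr _).
  rewrite [LHS]tgen0_tgen1 [RHS]tgen1_tgen0.
  by rewrite lactE ractE /= mulr0 mul0r mulrC.
elim/preproj_left_ind => [|x y Hx Hy|r'|s|s x Hx|s x Hx].
- by rewrite mulr0 mul0r.
- by rewrite mulrBr mulrBl Hx Hy.
- by rewrite mulrA -(rmorphM scal) [r * r']mulrC (rmorphM scal) -!mulrA comR.
- exact: comS.
- by rewrite !mulrA comM -(mulrA arrM) comS -!mulrA Hx.
- by rewrite !mulrA comS -(mulrA (atS s)) comN -!mulrA Hx.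
Qed.

Lemma in_center_gen (z : P) :
  z * vR = vR * z -> (forall s, z * atS s = atS s * z) ->
  z * arrM = arrM * z -> z * arrN = arrN * z -> in_center z.
Proof.
move=> comR comS comM comN.
elim/preproj_left_ind => [|x y Hx Hy|r|s|s x Hx|s x Hx].
- by rewrite mulr0 mul0r.
- by rewrite mulrBr mulrBl Hx Hy.
- by rewrite mulrA -scal_central -!mulrA comR.
- exact: comS.
- by rewrite !mulrA comM -(mulrA arrM) comS -!mulrA Hx.
- by rewrite !mulrA comS -(mulrA (atS s)) comN -!mulrA Hx.
Qed.

Lemma atSD s t : atS (s + t) = atS s + atS t.
Proof.
rewrite /atS -!rmorphD; congr (pr (tgen0 _ (_, _))).
by rewrite /= addr0.
Qed.

Lemma atS_linear : linear_over scal (atS : V -> P).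
Proof. by move=> r u v; rewrite scal_mul_atS atSD. Qed.

Lemma loopS_sqr : loopS * loopS = 0.
Proof. by rewrite /loopS mulrA -(mulrA arrN) arrM_arrN mulr0 mul0r. Qed.

Lemma arrM_atS1 : arrM * atS 1 = arrM.
Proof. by rewrite -[RHS]mulr1 -vR_atS mulrDr arrM_vR add0r. Qed.

Lemma atS1_arrN : atS 1 * arrN = arrN.
Proof. by rewrite -[RHS]mul1r -vR_atS mulrDl vR_arrN add0r. Qed.

Lemma arrM_arrM : arrM * arrM = 0.
Proof. by rewrite -[X in X * _]arrM_atS1 -mulrA atS_arrM mulr0. Qed.

Lemma arrN_arrN : arrN * arrN = 0.
Proof. by rewrite -[X in _ * X]atS1_arrN mulrA arrN_atS mul0r. Qed.

Lemma arrM_loopS : arrM * loopS = 0.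
Proof. by rewrite /loopS mulrA arrM_arrN mul0r. Qed.

Lemma loopS_arrN : loopS * arrN = 0.
Proof. by rewrite /loopS -mulrA arrM_arrN mulr0. Qed.

Lemma loopS_atS1 : loopS * atS 1 = loopS.
Proof. by rewrite /loopS -mulrA arrM_atS1. Qed.

Lemma atS1_loopS : atS 1 * loopS = loopS.
Proof. by rewrite /loopS mulrA atS1_arrN. Qed.

Definition loopR (s : V) : P := arrM * atS s * arrN.

Lemma loopR_linear : linear_over scal loopR.
Proof.
move=> r u v; rewrite /loopR atS_linear mulrDr mulrDl !mulrA.
by rewrite (scal_central r arrM).
Qed.

(** The trilinear map K to which [quartic_identity] is applied. *)
Definition linS_comm (v y w : V) : P :=
  atS v * loopS * atS y * loopS * atS w - atS w * loopS * atS y * loopS * atS v.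

Lemma linS_comm1 y w : linear_over scal (fun v => linS_comm v y w).
Proof.
move=> r u v; rewrite /linS_comm atS_linear !(mulrDl, mulrDr) mulrN.
move: loopS => x; rewrite !mulrA -(scal_central r (atS w * x * atS y * x)).
by rewrite !mulrA opprD addrACA.
Qed.

Lemma linS_comm3 v y : linear_over scal (linS_comm v y).
Proof.
move=> r u w; have E a b : linS_comm a y b = - linS_comm b y a.
  by rewrite /linS_comm opprB.
by rewrite E (linS_comm1 y v) opprD -mulrN -!E.
Qed.

Lemma linS_comm2 v w : linear_over scal (fun y => linS_comm v y w).
Proof.
move=> r u y; rewrite /linS_comm atS_linear !(mulrDl, mulrDr) mulrN.
move: loopS => x; rewrite !mulrA -(scal_central r (atS v * x)).
rewrite -(scal_central r (atS w * x)).
by rewrite !mulrA opprD addrACA.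
Qed.

Lemma linS_comm_alt v y : linS_comm v y v = 0.
Proof. exact: subrr. Qed.

Lemma linS_comm_one v w : linS_comm v 1 w = 0.
Proof.
have E a b : atS a * loopS * atS 1 * loopS * atS b = 0.
  by rewrite -(mulrA (atS a)) loopS_atS1 -(mulrA (atS a)) loopS_sqr mulr0 mul0r.
by rewrite /linS_comm !E subrr.
Qed.

Context (lambda : dual phi) (ef : dual_bases lambda e f).

(** The Casimir element is symmetric: expanding one factor in the other basis involves the symmetric
    matrix [lambda (e i * e j)]. *)
Lemma casimir_loop_sym : \sum_i atS (f i) * loopS * atS (e i) = 0.
Proof.
rewrite -[RHS]casimir_loop.
transitivity (\sum_i \sum_j
    scal (lambda (e i * e j)) * (atS (f i) * loopS * atS (f j))).
  apply: eq_bigr => i _; rewrite {1}(expand_right ef (e i)).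
  rewrite (linear_over_comb atS_linear) mulr_sumr; apply: eq_bigr => j _.
  by rewrite mulrA -scal_central -!mulrA.
rewrite exchange_big; apply: eq_bigr => j _ /=.
rewrite [e j in RHS](expand_right ef) (linear_over_comb atS_linear).
by rewrite !mulr_suml; apply: eq_bigr => i _; rewrite [e j * _]mulrC -!mulrA.
Qed.

(** The Casimir sum is a left factor of the first half of K and, in its symmetric form and after
    commuting [y] past [f i], a right factor of the second. *)
Lemma linS_comm_contr y w : \sum_i linS_comm (e i) (f i * y) w = 0.
Proof.
rewrite sumrB -[RHS](subrr 0); congr (_ - _).
  transitivity
    ((\sum_i atS (e i) * loopS * atS (f i)) * (atS y * loopS * atS w)).
    by rewrite mulr_suml; apply: eq_bigr => i _; rewrite atSM -!mulrA.
  by rewrite casimir_loop mul0r.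
transitivity ((atS w * loopS * atS y) * \sum_i atS (f i) * loopS * atS (e i)).
  rewrite mulr_sumr; apply: eq_bigr => i _.
  by rewrite [f i * y]mulrC atSM -!mulrA.
by rewrite casimir_loop_sym mulr0.
Qed.

End Preproj.

(** * Central elements in rank four, and finite generation over them *)

Section QuarticPreproj.
Context (R S : comPzRingType) (phi : {rmorphism R -> S}) (lambda : dual phi).
Context (e f : 'I_4 -> restr phi) (ef : dual_bases lambda e f).
Local Notation P := (preproj phi e f).
Local Notation V := (restr phi).
Local Notation scal := (scal (phi := phi) e f).
Local Notation vR := (vR (phi := phi) e f).
Local Notation atS := (atS (phi := phi) e f).
Local Notation a := (arrM (phi := phi) e f).
Local Notation b := (arrN (phi := phi) e f).
Local Notation x := (loopS (phi := phi) e f).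
Local Notation u := (loopR (phi := phi) e f).

(* The two components of a central element: [u_s ^+ 2] at the vertex R, and at
   the vertex S the only lift of it that can be central. *)
Definition centS (s : V) : P :=
  atS s * x * atS s * x + x * atS s * x * atS s + x * atS (s * s) * x
  - scal (\sum_i mulmat lambda e f s i i) * (x * atS s * x).

Definition centP (s : V) : P := u s * u s + centS s.

Lemma centS_comm s t : atS t * centS s = centS s * atS t.
Proof.
(* For this K the left side of the identity is t w(s) - w(s) t written out. *)
have /= := quartic_identity ef (linS_comm1 e f) (linS_comm2 e f)
  (linS_comm3 e f) (linS_comm_alt e f) (linS_comm_contr ef)
  (linS_comm_one e f) s t.
rewrite /linS_comm /centS.
have xS1 y : y * x * atS 1 = y * x by rewrite -mulrA loopS_atS1.
have tsC : atS t * atS s = atS s * atS t by rewrite -!atSM mulrC.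
rewrite [atS (t * s)]atSM !xS1 !atS1_loopS.
have : in_center (scal (\sum_i mulmat lambda e f s i i)).
  exact: scal_central.
move: (scal _) (loopS e f) (atS s) (atS t) tsC => c y p q qpC cC H.
apply/eqP; rewrite -subr_eq0 -{}H; apply/eqP.
rewrite !(mulrDl, mulrDr) mulrN mulNr subrACA; congr (_ - _); last first.
  by rewrite mulrN !mulrA -(cC q).
rewrite opprD addrACA; congr (_ + _); last by rewrite !mulrA.
rewrite [X in _ - X]addrC opprD addrACA !mulrA -(mulrA _ p q) -qpC.
by rewrite !mulrA.
Qed.

Let scalCA r y z : y * (scal r * z) = scal r * (y * z).
Proof. by rewrite !mulrA scal_central. Qed.

Let arrM_centS s : a * centS s = u s * u s * a.
Proof.
have -> : u s * u s * a = a * (atS s * x * atS s * x).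
  by rewrite /loopR /loopS !mulrA.
rewrite /centS mulrBr !mulrDr scalCA.
move: (loopS e f) (arrM_loopS e f) => y ay.
have y0 p : a * (y * p * y) = 0 by rewrite !mulrA ay !mul0r.
by rewrite !y0 mulr0 subr0 !mulrA ay !mul0r !addr0.
Qed.

Let centS_arrN s : centS s * b = b * (u s * u s).
Proof.
have -> : b * (u s * u s) = x * atS s * x * atS s * b.
  by rewrite /loopR /loopS !mulrA.
rewrite /centS mulrBl !mulrDl; move: (loopS e f) (loopS_arrN e f) => y yb.
by rewrite -!mulrA yb !mulr0 subr0 addr0 add0r.
Qed.

(** This product and the next three vanish because the adjacent ends of the factors lie at different
    vertices. *)
Let vR_centS s : vR * centS s = 0.
Proof.
have : vR * x = 0 by rewrite /loopS mulrA vR_arrN mul0r.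
rewrite /centS mulrBr !mulrDr scalCA; move: (loopS e f) => y vy.
have y0 p : vR * (y * p * y) = 0 by rewrite !mulrA vy !mul0r.
by rewrite !y0 mulr0 subr0 !mulrA vy vR_mul_atS !mul0r !addr0.
Qed.

Let centS_vR s : centS s * vR = 0.
Proof.
have : x * vR = 0 by rewrite /loopS -mulrA arrM_vR mulr0.
rewrite /centS mulrBl !mulrDl; move: (loopS e f) => y yv.
by rewrite -!mulrA yv atS_mul_vR !mulr0 subr0 !addr0.
Qed.

Let centS_arrM s : centS s * a = 0.
Proof.
have : x * a = 0 by rewrite /loopS -mulrA arrM_arrM mulr0.
rewrite /centS mulrBl !mulrDl; move: (loopS e f) => y ya.
by rewrite -!mulrA ya atS_arrM !mulr0 subr0 !addr0.
Qed.

Let arrN_centS s : b * centS s = 0.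
Proof.
have : b * x = 0 by rewrite /loopS mulrA arrN_arrN mul0r.
rewrite /centS mulrBr !mulrDr scalCA; move: (loopS e f) => y biy.
have y0 p : b * (y * p * y) = 0 by rewrite !mulrA biy !mul0r.
by rewrite !y0 mulr0 subr0 !mulrA biy arrN_atS !mul0r !addr0.
Qed.

Lemma vR_loopR s : vR * u s = u s.
Proof. by rewrite /loopR !mulrA vR_arrM. Qed.

Lemma centP_vR s : centP s * vR = u s * u s.
Proof.
by rewrite /centP mulrDl centS_vR addr0 -mulrA /loopR -!mulrA arrN_vR.
Qed.

Lemma centP_central s : in_center (centP s).
Proof.
apply: in_center_gen => [|t||].
- by rewrite centP_vR /centP mulrDr vR_centS addr0 mulrA vR_loopR.
- rewrite /centP mulrDl mulrDr centS_comm; congr (_ + _).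
  by rewrite /loopR -!mulrA arrN_atS !mulrA atS_arrM !(mul0r, mulr0).
- rewrite /centP mulrDl mulrDr centS_arrM arrM_centS.
  by rewrite addr0 {2}/loopR !mulrA arrM_arrM !mul0r add0r.
- rewrite /centP mulrDl mulrDr centS_arrN arrN_centS addr0.
  by rewrite {1 2}/loopR -!mulrA arrN_arrN !mulr0 add0r.
Qed.

(** Polarisation of u_s^2 = z(s) [vR]: the Clifford relations with central coefficients. *)
Lemma loopRM s t : u s * u t + u t * u s =
  (centP (s + t) - centP s - centP t) * vR.
Proof.
rewrite !mulrBl !centP_vR (linear_overD (loopR_linear e f)) mulrDl !mulrDr.
by rewrite addrAC addrA addrK -(addrA (u s * u s)) [X in _ = X - _]addrC addrK.
Qed.

(** The spanning list consists of the 16 ordered monomials in the u_{e_i}, multiplied on the left by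
    1 or some e_i b and on the right by 1 or some a e_j, together with the e_i. Its span contains
    degree 0 and is stable under left multiplication by arrows. *)
Lemma preproj_span (B : P -> Prop) : central_subring B ->
  (forall r, B (scal r)) ->
  (forall i, B (centP (e i))) -> (forall i j, B (centP (e i + e j))) ->
  exists l, forall y, span B l y.
Proof.
move=> Bring Bscal Be Bee.
pose c i := e (inord i); pose v i := u (c i).
(* Products of distinct [v i] with i < k, indices decreasing from left to right and ending in
   [vR]. *)
pose G := fix G k := if k is k'.+1 then G k' ++ [seq v k' * g | g <- G k']
  else [:: vR].
have SM l := span_submodule l Bring.
have [_ BB BM BC] := Bring.
have vRG k m : span B (G k) m -> vR * m = m.
  apply: (span_min (L := fun m => vR * m = m)).
    split=> [|y z yE zE|d y Bd yE]; first exact: mulr0.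
      by rewrite mulrBr yE zE.
    by rewrite mulrA -(BC _ Bd) -mulrA yE.
  elim: k => [|k IH] g /=; first by rewrite inE => /eqP ->; apply: vR_idem.
  rewrite mem_cat => /orP[/IH//|/mapP[h _ ->]].
  by rewrite mulrA vR_loopR.
have stepl k m : span B (G k) m -> span B (G k.+1) m.
  by apply: (span_catl _ Bring).
have stepr k m : span B (G k) m -> span B (G k.+1) (v k * m).
  move=> Hm; rewrite -[_ * m]mulr1; apply: (span_sandwich Bring _ Hm) => g.
  case/mapP=> h hk ->; rewrite mulr1 mem_cat; apply/orP; right.
  exact: map_f.
(* Clifford normal ordering: the squares and anticommutators of the [v j] have
   coefficients in B. *)
have vG k j m : (j < k)%N -> span B (G k) m -> span B (G k) (v j * m).
  elim: k j m => [//|k IH] j m jk Hm.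
  have [m1 [m2 [-> Hm1 Hm2]]] : exists m1 m2,
      [/\ m = m1 + v k * m2, span B (G k) m1 & span B (G k) m2].
    move: Hm; apply: (span_min (L := fun m => exists m1 m2,
      [/\ m = m1 + v k * m2, span B (G k) m1 & span B (G k) m2])).
      have [S0 SB SZ] := SM (G k); split.
      - by exists 0, 0; rewrite mulr0 addr0.
      - move=> _ _ [g1 [g2 [-> ? ?]]] [h1 [h2 [-> ? ?]]].
        exists (g1 - h1), (g2 - h2); split; [|exact: SB|exact: SB].
        by rewrite opprD addrACA mulrBr.
      - move=> d _ Bd [g1 [g2 [-> ? ?]]]; exists (d * g1), (d * g2).
        split; [|exact: SZ|exact: SZ].
        by rewrite mulrDr (mulrA (v k)) -(BC _ Bd) -mulrA.
    move=> g; rewrite mem_cat => /orP[gk|/mapP[h hk ->]].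
      exists g, 0; rewrite mulr0 addr0; split=> //; last by case: (SM (G k)).
      exact: span_mem.
    exists 0, h; rewrite add0r; split=> //; first by case: (SM (G k)).
    exact: span_mem.
  have SD := submodule_add (SM (G k.+1)).
  have [_ _ SZ] := SM (G k.+1).
  rewrite mulrDr; move: jk; rewrite ltnS leq_eqVlt => /orP[/eqP ->|jk].
    apply: SD; first exact: stepr.
    rewrite mulrA /v -centP_vR -mulrA (vRG k) //.
    by apply: SZ; [apply: Be|apply: stepl].
  apply: SD; first by apply/stepl/IH.
  rewrite mulrA.
  (* For j < k the anticommutator moves [v j] to the right of [v k], where the induction hypothesis
     applies. *)
  have -> : v j * v k * m2 =
      (centP (c j + c k) - centP (c j) - centP (c k)) * m2 - v k * (v j * m2).
    rewrite -[in RHS](vRG k m2 Hm2) [X in X - _]mulrA -loopRM (vRG k) //.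
    by rewrite mulrDl !mulrA addrK.
  case: (SM (G k.+1)) => _ + _; apply; last by apply/stepr/IH.
  apply: SZ; last exact: stepl.
  by apply: (BB); [apply: (BB)|]; [apply: Bee|apply: Be|apply: Be].
have uG s m : span B (G 4) m -> span B (G 4) (u s * m).
  move=> Hm; have [_ _ SZ] := SM (G 4).
  rewrite {1}(expand_left ef s) (linear_over_comb (loopR_linear e f)).
  rewrite mulr_suml; apply: (submodule_sum (SM (G 4))) => i.
  rewrite -mulrA; apply: SZ; first exact: Bscal.
  have -> : e i = c i by rewrite /c inord_val.
  exact: vG.
pose ls := 1 :: [seq atS (e i) * b | i <- enum 'I_4].
pose rs := 1 :: [seq a * atS (e i) | i <- enum 'I_4].
have ls_e i : atS (e i) * b \in ls.
  by rewrite inE; apply/orP; right; apply: map_f; rewrite mem_enum.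
have rs_e i : a * atS (e i) \in rs.
  by rewrite inE; apply/orP; right; apply: map_f; rewrite mem_enum.
pose l :=
  [seq yz.1 * g * yz.2 | yz <- [seq (y, z) | y <- ls, z <- rs], g <- G 4]
  ++ [seq atS (e i) | i <- enum 'I_4].
have lG y z m : y \in ls -> z \in rs -> span B (G 4) m -> span B l (y * m * z).
  move=> yl zr Hm; apply: (span_sandwich Bring _ Hm) => _ /mapP[g gG ->].
  rewrite mem_cat; apply/orP; left.
  by apply/allpairsP; exists ((y, z), g); split=> //; apply/allpairs_f.
have [S0 SB SZ] := SM l.
have lS s : span B l (atS s).
  rewrite (expand_left ef s) (linear_over_comb (atS_linear e f)).
  apply: (submodule_sum (SM l)) => i; apply: SZ; first exact: Bscal.
  apply: span_mem => //; rewrite mem_cat; apply/orP; right.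
  by apply: map_f; rewrite mem_enum.
have vRG4 : span B (G 4) vR.
  by do 4!apply: (stepl); apply: span_mem => //; rewrite inE.
(* Stability under a B-linear map is tested on the two kinds of generators. *)
have lgen (h : P -> P) : (forall y z, h (y - z) = h y - h z) ->
    (forall d y, B d -> h (d * y) = d * h y) ->
    (forall y z m, y \in ls -> z \in rs -> span B (G 4) m ->
       span B l (h (y * m * z))) ->
    (forall i, span B l (h (atS (e i)))) ->
    forall y, span B l y -> span B l (h y).
  move=> hB hZ h1 h2 y; apply: (span_min (L := fun y => span B l (h y))).
    split=> [|g g' Hg Hg'|d g Bd Hg]; first by rewrite -(subrr 0) hB subrr.
      by rewrite hB; apply: SB.
    by rewrite hZ //; apply: SZ.
  move=> g; rewrite mem_cat => /orP[/allpairsP[[yz g'] [yzl g'G ->]]|].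
    case/allpairsP: yzl => -[y' z'] [yl zr /= ->].
    exact: (h1 _ _ _ yl zr (span_mem Bring g'G)).
  by case/mapP=> i _ ->.
exists l; elim/preproj_left_ind => //.
- move=> r; apply: SZ; first exact: Bscal.
  rewrite -[vR]mul1r -[1 * vR]mulr1.
  exact: (lG _ _ _ (mem_head _ _) (mem_head _ _) vRG4).
- move=> s; apply: lgen.
  + exact: mulrBr.
  + by move=> d y Bd; rewrite mulrA -(BC _ Bd) -mulrA.
  (* Left multiplication by a s kills a word starting at R, and merges with a prefix e_i b into the
     loop u_{s e_i}. *)
  + move=> y z m; rewrite inE => /orP[/eqP ->|/mapP[i _ ->]] zr Hm.
      by rewrite mul1r -(vRG _ _ Hm) !mulrA -(mulrA a) atS_mul_vR mulr0 !mul0r.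
    rewrite !mulrA -(mulrA a) -atSM -/(u (s * e i)) -[_ * m]mul1r.
    exact: (lG _ _ _ (mem_head _ _) zr (uG _ _ Hm)).
  + move=> i; rewrite -mulrA -atSM; set t := s * e i.
    rewrite (expand_left ef t) (linear_over_comb (atS_linear e f)) mulr_sumr.
    apply: (submodule_sum (SM l)) => j; rewrite mulrA -scal_central -mulrA.
    apply: SZ; first exact: Bscal.
    rewrite -[X in X * _]vR_arrM -mulrA -[vR]mul1r.
    exact: (lG _ _ _ (mem_head _ _) (rs_e j) vRG4).
- move=> s; apply: lgen.
  + exact: mulrBr.
  + by move=> d y Bd; rewrite mulrA -(BC _ Bd) -mulrA.
  (* Left multiplication by s b adds prefixes e_j b to a word starting at R, and kills one starting
     at S. *)
  + move=> y z m; rewrite inE => /orP[/eqP ->|/mapP[i _ ->]] zr Hm.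
      rewrite mul1r {1}(expand_left ef s) (linear_over_comb (atS_linear e f)).
      rewrite !mulr_suml; apply: (submodule_sum (SM l)) => j.
      rewrite -!(mulrA (scal _)) (mulrA _ m z); apply: SZ; first exact: Bscal.
      exact: (lG _ _ _ (ls_e j) zr Hm).
    by rewrite !mulrA -(mulrA (atS s) b) arrN_atS mulr0 !mul0r.
  + by move=> i; rewrite -mulrA arrN_atS mulr0.
Qed.

End QuarticPreproj.

(** * Noetherianity and finiteness over the center *)

Theorem theorem5p1 (R S : comPzRingType) (phi : {rmorphism R -> S})
    (lambda : dual phi) (e f : 'I_4 -> restr phi) :
  noetherian R ->
  relative_frobenius phi 4 ->
  dual_generator lambda ->
  dual_bases lambda e f ->
  noetherian (preproj phi e f) /\ finite_over_center (preproj phi e f).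
Proof.
move=> [Rn _] _ _ ef.
have [B0ring B0n] := noeth_image Rn (scal_central (e := e) (f := f)).
(* The z(e_i) give the squares of the Clifford generators; with the z(e_i + e_j) they give the
   anticommutators. *)
pose zs := [seq centP lambda e f (e i) | i <- enum 'I_4] ++
  [seq centP lambda e f (e i + e j) | i <- enum 'I_4, j <- enum 'I_4].
have [z|B [Bring Bn BB0 Bzs]] := noeth_adjoin_seq (zs := zs) B0ring B0n.
  by rewrite mem_cat => /orP[/mapP[i _ ->]|/allpairsP[[i j] [_ _ ->]]];
    apply: centP_central.
have [r|i|i j|l Pl] := preproj_span ef Bring.
- by apply: BB0; exists r.
- apply: Bzs; rewrite mem_cat; apply/orP; left.
  by apply: map_f; rewrite mem_enum.
- apply: Bzs; rewrite mem_cat; apply/orP; right.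
  by apply/allpairs_f; rewrite mem_enum.
exact: finite_over_noeth Bring Bn Pl.
Qed.
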